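(* Let $0\neq\omega\in\mathbb R$, $1<r\le2$, let $J$ be an interval of the form $[\alpha,\infty)$, $(\alpha,\infty)$ ($\alpha\in\mathbb R$) or $\mathbb R$, let $X$ be a complex Banach space, and let $U,V\in\{BUC(J,X),UC(J,X)\}$. Then $U+g_{\omega,r}V$ satisfies $(L_b)$ and $(P_b)$.
   Context: $X\ne\{0\}$. $g_{\omega,r}(t)=e^{i\omega|t|^r}$. $UC$, $BUC$: uniformly continuous, bounded uniformly continuous functions. $U+\gamma V=\{u+\gamma v:u\in U,v\in V\}$. $L^1_{\rm loc}(J,X)$: all functions $J\to X$ (not equivalence classes) Bochner–Lebesgue integrable over every compact interval contained in $J$; $L^\infty(J,X)$: all Bochner–Lebesgue measurable functions $J\to X$ that are bounded everywhere on $J$. $(\Delta_hf)(t)=f(t+h)-f(t)$. $(Pf)(t)=\int_{\alpha_0}^tf(s)\,ds$ with a fixed $\alpha_0\in J$ ($\alpha_0=0$ if $0\in J$). For $A\subset L^1_{\rm loc}(J,X)$: $A$ satisfies $(L_b)$ if $f\in L^\infty(J,X)$ and $\Delta_hf\in A$ for all $h>0$ imply $f\in A$; $A$ satisfies $(P_b)$ if $f\in A$ and $Pf$ bounded imply $Pf\in A$. *)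

(* Defs.v *)
From HB Require Import structures.
From mathcomp Require Import all_boot all_order all_algebra.
From mathcomp Require Import all_classical all_reals all_analysis.
From mathcomp Require Import complex.

Set Implicit Arguments.
Unset Strict Implicit.
Unset Printing Implicit Defensive.

Import Order.TTheory GRing.Theory Num.Theory.
Import numFieldNormedType.Exports.
Local Open Scope classical_set_scope.
Local Open Scope complex_scope.
Local Open Scope ring_scope.

(* MathComp-Analysis integrates only (extended) real-valued functions, so the
   Bochner integral is set up here by approximation with simple functions. *)
Section Bochner.
Context d (T : measurableType d) (R : realType) (mu : {measure set T -> \bar R})
  (X : completeNormedModType R[i]).
Implicit Types (D : set T) (f s : T -> X) (u : nat -> T -> X) (v : X).

Definition simple_function s :=
  finite_set (range s) /\ forall x, measurable (s @^-1` [set x]).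

Definition simple_ae_cvg D f u :=
  (forall n, simple_function (u n)) /\
  {ae mu, forall t, D t -> u n t @[n --> \oo] --> f t}.

Definition bochner_measurable D f := exists u, simple_ae_cvg D f u.

Definition simple_integrable D s :=
  forall x, x != 0 -> (mu (D `&` s @^-1` [set x]) < +oo)%E.

(* The term x = 0, where the measure may be infinite, contributes 0. *)
Definition simple_integral D s : X :=
  \sum_(x \in range s) (fine (mu (D `&` s @^-1` [set x])))%:C *: x.

(* The norm of X takes its values in the real elements of R[i]. *)
Definition bochner_approx D f u :=
  [/\ simple_ae_cvg D f u,
      forall n, simple_integrable D (u n) &
      (\int[mu]_(t in D) (complex.Re `|f t - u n t|)%:E)%E @[n --> \oo]
        --> 0%E].

Definition bochner_integrable D f := exists u, bochner_approx D f u.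

Definition is_bochner_integral D f v :=
  exists2 u, bochner_approx D f u &
    simple_integral D (u n) @[n --> \oo] --> v.

Definition bochner_integral D f : X := get (is_bochner_integral D f).

End Bochner.

(* A function J -> X is represented by a function R -> X of which only the
   values on J matter: every set of functions below is invariant under changes
   of its elements outside of J. *)
Section FunctionSpaces.
Context (R : realType) (X : completeNormedModType R[i]).
Implicit Types (J : set R) (f : R -> X) (A U V : set (R -> X)).

Definition UC J : set (R -> X) :=
  [set f | unif_continuous (f : subspace J -> X)].

Definition BUC J : set (R -> X) :=
  [set f | UC J f /\ [bounded f t | t in J]].

Definition L1loc J : set (R -> X) :=
  [set f | forall a b : R, `[a, b]%classic `<=` J ->
    bochner_integrable completed_lebesgue_measure `[a, b]%classic f].

Definition Linfty J : set (R -> X) :=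
  [set f | bochner_measurable completed_lebesgue_measure J f /\
           [bounded f t | t in J]].

Definition sum_mul J (gamma : R -> R[i]) U V : set (R -> X) :=
  [set f | exists u v, [/\ U u, V v &
    forall t, J t -> f t = u t + gamma t *: v t]].

Definition difference (h : R) f : R -> X := fun t => f (t + h) - f t.

Definition primitive (alpha0 : R) f : R -> X := fun t =>
  if alpha0 <= t
  then bochner_integral completed_lebesgue_measure `[alpha0, t]%classic f
  else - bochner_integral completed_lebesgue_measure `[t, alpha0]%classic f.

(* The properties (L_b) and (P_b) are those of subsets A of L1loc, hence the
   first conjuncts. *)
Definition satisfies_Lb J A :=
  A `<=` L1loc J /\
  forall f, Linfty J f -> (forall h, 0 < h -> A (difference h f)) -> A f.

Definition satisfies_Pb (alpha0 : R) J A :=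
  A `<=` L1loc J /\
  forall f, A f -> [bounded primitive alpha0 f t | t in J] ->
    A (primitive alpha0 f).

End FunctionSpaces.

(* e^{i omega |t|^r} *)
Definition g {R : realType} (omega r : R) : R -> R[i] := fun t =>
  cos (omega * `|t| `^ r) +i* sin (omega * `|t| `^ r).

Definition unbounded_right_interval {R : realType} (J : set R) :=
  [\/ exists alpha : R, J = `[alpha, +oo[%classic,
      exists alpha : R, J = `]alpha, +oo[%classic | J = setT].

(* Main.v *)
Require Import Defs.
From HB Require Import structures.
From mathcomp Require Import all_boot all_order all_algebra.
From mathcomp Require Import finmap.
From mathcomp Require Import all_classical all_reals all_analysis.
From mathcomp Require Import measurable_realfun.
From mathcomp Require Import complex.
From mathcomp Require Import ring lra.

Set Implicit Arguments.
Unset Strict Implicit.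
Unset Printing Implicit Defensive.

Import Order.TTheory GRing.Theory Num.Theory.
Import numFieldNormedType.Exports.
Local Open Scope classical_set_scope.
Local Open Scope complex_scope.
Local Open Scope ring_scope.

(** Write g for e^(i omega |t|^r), p for its phase omega |t|^r and F for the
    primitive of f. Both properties follow from one criterion
    (bounded_decomposition): a bounded function f on J, uniformly continuous on
    bounded parts of J, lies in BUC + g BUC as soon as the alternating form
      altg f s1 s2 s3 = (g s3 - g s1) (f s2 - f s1) + (g s1 - g s2) (f s3 - f s1)
    is uniformly small on triples of small diameter. The form is the determinant
    with rows (1, 1, 1), (g s1, g s2, g s3) and (f s1, f s2, f s3); it kills all
    functions c + g d with c and d constant, so it is small on u + g v when u and
    v hardly move over a small triple. Conversely, as r > 1 the oscillation of g
    becomes arbitrarily fast, and every t with |t| large has a close neighbour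
    theta t with g (theta t) = - g t. Then u = (f + f o theta) / 2 and
    v = (f - f o theta) / (2 g) solve f = u + g v, and smallness of altg f on the
    triples (t, theta t, s) and (t, theta t, theta s) shows that u and v change
    little from t to s.

    For (L_b), consider functionals a |-> c2 (a s2 - a s1) + c3 (a s3 - a s1),
    of which altg and a |-> a s - a t are instances, along sequences of triples
    whose diameters tend to 0. If they tend to 0 on every difference of f, they
    tend to 0 on f itself (dipole_small). Indeed their value at the difference
    with step h is their value at the translate of f by h minus their value at f.
    As f is measurable, convergence for each h gives convergence in measure on
    ]0, 1[, so that an entire N x N grid h + j (s2 - s1) + l (s3 - s1) of good
    steps exists; averaged over this grid the values at the translates telescope
    to O(1/N), because f is bounded. The criterion then applies to f.

    For (P_b), let f = u + g v with F bounded. Freezing u, v and p' at t gives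
      F s - F t = (s - t) u t + (g s - g t) W + O(s - t),  W = v t / (i p' t),
    for |t| >= 2 and |s - t| <= 1 (primitive_expansion). The remainder is
    controlled because v grows at most linearly while |p' s / p' t - 1| is at
    most |s - t| / |t|, which is where r <= 2 enters. Taking s = theta t and
    s = t + 1 shows that u is bounded; since altg does not see the multiple of g,
    altg F is then O(diameter), and the criterion applies to F.

    Of the Bochner integral, the proof uses additivity over adjacent segments and
    the fact that the integral of f over [s, t] differs from (t - s) c by at most
    (t - s) sup |f - c|. A mean value inequality obtained by subdivision takes
    the place of differentiation in X. *)

(** * Real-valued norms and uniform continuity *)

Section RealNorm.
Context {R : realType}.

(** The norm of X takes its values in the real elements of R[i]; passing to R
    makes total orders, real integrals and linear arithmetic available. *)
Definition rnorm {V : normedZmodType R[i]} (x : V) : R := complex.Re `|x|.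

Lemma normE {V : normedZmodType R[i]} (x : V) : `|x| = (rnorm x)%:C.
Proof.
have := normr_ge0 x; rewrite /rnorm.
by case: `|x| => a b; rewrite lecE /= => /andP[/eqP-> _].
Qed.

Lemma lec (a b : R) : (a%:C <= b%:C) = (a <= b).
Proof. by rewrite lecE /= eqxx. Qed.

Lemma ltc (a b : R) : (a%:C < b%:C) = (a < b).
Proof. by rewrite !lt_neqAle lec (inj_eq (@complexI R)). Qed.

Lemma rnorm_ge0 {V : normedZmodType R[i]} (x : V) : 0 <= rnorm x.
Proof. by rewrite -lec -normE; exact: normr_ge0. Qed.

Lemma rnormD {V : normedZmodType R[i]} (x y : V) :
  rnorm (x + y) <= rnorm x + rnorm y.
Proof. by rewrite -lec rmorphD /= -!normE ler_normD. Qed.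

Lemma rnormN {V : normedZmodType R[i]} (x : V) : rnorm (- x) = rnorm x.
Proof. by rewrite /rnorm normrN. Qed.

Lemma rnormB {V : normedZmodType R[i]} (x y : V) :
  rnorm (x - y) <= rnorm x + rnorm y.
Proof. by rewrite -(rnormN y) rnormD. Qed.

Lemma rdistC {V : normedZmodType R[i]} (x y : V) : rnorm (x - y) = rnorm (y - x).
Proof. by rewrite -rnormN opprB. Qed.

Lemma rdistD {V : normedZmodType R[i]} (y x z : V) :
  rnorm (x - z) <= rnorm (x - y) + rnorm (y - z).
Proof. by rewrite -[x in leLHS](subrK y) -addrA rnormD. Qed.

Lemma rnorm0 {V : normedZmodType R[i]} : rnorm (0 : V) = 0.
Proof. by rewrite /rnorm normr0. Qed.

Lemma rnorm_eq0 {V : normedZmodType R[i]} (x : V) : rnorm x = 0 -> x = 0.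
Proof. by move=> x0; apply/normr0_eq0; rewrite normE x0. Qed.

Lemma rnorm_sum {V : normedZmodType R[i]} (I : Type) (s : seq I) (P : pred I)
    (F : I -> V) :
  rnorm (\sum_(i <- s | P i) F i) <= \sum_(i <- s | P i) rnorm (F i).
Proof.
elim/big_ind2 : _ => [|x a y b xa yb|//]; first by rewrite rnorm0.
by rewrite (le_trans (rnormD _ _))// lerD.
Qed.

Lemma rnormZ {V : normedModType R[i]} (c : R[i]) (x : V) :
  rnorm (c *: x) = rnorm c * rnorm x.
Proof. by apply/complexI; rewrite rmorphM /= -!normE normrZ. Qed.

Lemma rnormM (c d : R[i]) : rnorm (c * d) = rnorm c * rnorm d.
Proof. by apply/complexI; rewrite rmorphM /= -!normE normrM. Qed.

Lemma rnormE (a b : R) : rnorm (a +i* b) = Num.sqrt (a ^+ 2 + b ^+ 2).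
Proof. by rewrite /rnorm normc_def. Qed.

Lemma rnorm_real (a : R) : rnorm (a%:C) = `|a|.
Proof. by rewrite rnormE expr0n addr0 sqrtr_sqr. Qed.

Lemma rnorm_nat n : rnorm (n%:R : R[i]) = n%:R.
Proof. by rewrite -(rmorph_nat (real_complex R)) /= rnorm_real ger0_norm. Qed.

Lemma rnormV (c : R[i]) : rnorm c^-1 = (rnorm c)^-1.
Proof. by apply/complexI; rewrite fmorphV /= -!normE normfV. Qed.

Lemma rnorm_complex_le (a b : R) : rnorm (a +i* b) <= `|a| + `|b|.
Proof.
rewrite (_ : a +i* b = a%:C + 'i%C * b%:C); last exact: (complexE (a +i* b)).
rewrite (le_trans (rnormD _ _))// rnorm_real rnormM rnorm_real.
by rewrite rnormE expr0n expr1n add0r sqrtr1 mul1r.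
Qed.

End RealNorm.

Lemma posc_Re {R : realType} (e : R[i]) :
  0 < e -> 0 < complex.Re e /\ e = (complex.Re e)%:C.
Proof. by case: e => a b; rewrite ltcE /= => /andP[/eqP-> ->]. Qed.

Section UniformContinuity.
Context {R : realType}.

(** Radii range over R, whereas the entourages of X are indexed by R[i]. *)
Definition ucont (V : normedZmodType R[i]) (J : set R) (f : R -> V) :=
  forall e : R, 0 < e -> exists2 d : R, 0 < d &
    forall s t, J s -> J t -> `|s - t| < d -> rnorm (f s - f t) < e.

Definition bounded_on (V : normedZmodType R[i]) (J : set R) (f : R -> V) :=
  exists M : R, forall t, J t -> rnorm (f t) <= M.

Context (X : completeNormedModType R[i]).

Lemma UC_ucont (J : set R) (f : R -> X) : UC J f <-> ucont J f.
Proof.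
rewrite /UC /= /unif_continuous; split.
  move=> fu e e0.
  have : entourage [set xy : X * X | ball xy.1 (e%:C) xy.2].
    by rewrite -entourage_ballE; exists e%:C => //=; rewrite ltc.
  move/fu; rewrite /fmap /= /nbhs /= -entourage_ballE => -[d /= d0 dsub].
  exists d => // s t Js Jt st.
  have := dsub (s, t); rewrite /= -ball_normE /= normE ltc; apply.
  rewrite ball_subspace_ball /subspace_ball /=.
  by rewrite ifT ?inE// -ball_normE.
move=> fu A; rewrite -entourage_ballE => -[e /= /posc_Re[e0 ->] eA].
have [d d0 fd] := fu _ e0.
rewrite /fmap /= /nbhs /= -entourage_ballE; exists d => //= -[s t] /=.
rewrite ball_subspace_ball /subspace_ball; case: ifPn; last first.
  by move=> _ ->; apply: eA => /=; apply: ballxx; rewrite ltc.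
rewrite inE => Js [Jt]; rewrite -ball_normE /= => st; apply: eA => /=.
by rewrite -ball_normE /= normE ltc fd.
Qed.

Lemma bounded_onP (J : set R) (f : R -> X) :
  [bounded f t | t in J] <-> bounded_on J f.
Proof.
split.
  move=> [M [Mr fM]]; exists (complex.Re M + 1) => t Jt.
  have [a Ma] : exists a : R, M = a%:C by apply/complex_realP.
  move: fM; rewrite {}Ma /= => fM.
  by have := fM (a + 1)%:C; rewrite ltc ltrDl ltr01 => /(_ isT t Jt) /=; rewrite normE lec.
move=> [M fM]; exists M%:C; split; first by apply/complex_realP; exists M.
move=> x Mx t Jt /=; apply: le_trans (ltW Mx).
by rewrite normE lec fM.
Qed.

Lemma cvg_rnorm (u : nat -> X) (l : X) :
  (u n @[n --> \oo] --> l) <->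
  forall e : R, 0 < e -> \forall n \near \oo, rnorm (l - u n) < e.
Proof.
split=> [/cvgrPdist_lt ul e e0|ul].
  have /ul : 0 < e%:C by rewrite ltc.
  by apply: filterS => n; rewrite normE ltc.
apply/cvgrPdist_lt => e /posc_Re[/ul ue ->].
by near do rewrite normE ltc.
Unshelve. all: by end_near. Qed.

End UniformContinuity.

(** * Subdivision of intervals *)

Section Subdivision.
Context {R : realType} {V : normedZmodType R[i]}.

Lemma rnorm_subdivision (f : R -> V) (a b e : R) (n : nat) : a <= b ->
  (forall s t, a <= s -> s <= t -> t <= b -> t - s = (b - a) / n.+1%:R ->
    rnorm (f t - f s) <= e) ->
  rnorm (f b - f a) <= n.+1%:R * e.
Proof.
move=> ab fe; set h := (b - a) / n.+1%:R.
have h0 : 0 <= h by rewrite divr_ge0// subr_ge0.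
have nh : n.+1%:R * h = b - a by rewrite mulrC divfK// pnatr_eq0.
have -> : f b - f a = \sum_(0 <= k < n.+1) (f (a + k.+1%:R * h) - f (a + k%:R * h)).
  rewrite (telescope_sumr (fun k => f (a + k%:R * h)))// mul0r addr0 nh.
  by rewrite (addrC a) subrK.
rewrite big_mkord (le_trans (rnorm_sum _ _ _))//.
rewrite -[n.+1 in leRHS]card_ord mulr_natl -sumr_const; apply: ler_sum => i _.
have step : a + i.+1%:R * h - (a + i%:R * h) = h by rewrite -(natr1 i); ring.
apply: fe; rewrite ?step//.
- by rewrite lerDl mulr_ge0.
- by rewrite -subr_ge0 step.
- by rewrite -lerBrDl -nh ler_wpM2r// ler_nat.
Qed.

(** Only increments over short steps are compared with C, so that no derivative
    of a vector-valued function of a real variable is involved. *)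
Lemma rnorm_mean_value (f : R -> V) (a b C : R) : a <= b ->
  (forall e, 0 < e -> exists2 d, 0 < d &
    forall s t, a <= s -> s <= t -> t <= b -> t - s < d ->
    rnorm (f t - f s) <= (C + e) * (t - s)) ->
  rnorm (f b - f a) <= C * (b - a).
Proof.
move=> ab fC; apply/ler_addgt0Pr => e e0.
have ba1 : 0 < b - a + 1 by rewrite ltr_wpDl ?subr_ge0.
have [d d0 fd] := fC (e / (b - a + 1)) (divr_gt0 e0 ba1).
pose n := Num.truncn ((b - a) / d).
have hd : (b - a) / n.+1%:R < d.
  by rewrite ltr_pdivrMr ?ltr0Sn// mulrC -ltr_pdivrMr// truncnS_gt.
apply: (@le_trans _ _ (n.+1%:R * ((C + e / (b - a + 1)) * ((b - a) / n.+1%:R)))).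
  by apply: rnorm_subdivision => // s t ats st tb tsE; rewrite -tsE fd// tsE.
rewrite mulrCA [_ * (_ / _)]mulrC divfK ?pnatr_eq0//.
rewrite mulrDl lerD2l mulrAC ler_pdivrMr// ler_pM2l//.
by rewrite lerDl.
Qed.

(** The interval from s to t is covered by steps on which f moves by less than 1. *)
Lemma ucont_linear_growth (J : set R) (f : R -> V) :
  is_interval J -> ucont J f -> exists2 C : R, 0 < C &
    forall s t, J s -> J t -> rnorm (f s - f t) <= C * (1 + `|s - t|).
Proof.
move=> Jitv fu; have [d d0 fd] := fu _ ltr01.
exists (1 + d^-1); first by rewrite addr_gt0// invr_gt0.
have main s t : J s -> J t -> s <= t -> rnorm (f t - f s) <= (1 + d^-1) * (1 + (t - s)).
  move=> Js Jt st; have ts0 : 0 <= t - s by rewrite subr_ge0.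
  pose n := Num.truncn ((t - s) / d).
  have n1 : n%:R <= (t - s) / d by rewrite truncn_le divr_ge0// ltW.
  apply: (@le_trans _ _ (n.+1%:R * 1)).
    apply: rnorm_subdivision => // x y sx xy yt xyE.
    apply/ltW/fd; [apply: (Jitv s t)|apply: (Jitv s t)|] => //.
    - by rewrite (le_trans sx).
    - by rewrite sx (le_trans xy).
    - rewrite ger0_norm ?subr_ge0// xyE.
      by rewrite ltr_pdivrMr ?ltr0Sn// mulrC -ltr_pdivrMr// truncnS_gt.
  rewrite mulr1 -natr1 (le_trans (lerD n1 (lexx 1)))//.
  have := ltW d0; rewrite -invr_ge0; move: (d^-1) => w w0; nra.
move=> s t Js Jt; case: (leP s t) => st.
  by rewrite rdistC distrC ger0_norm ?subr_ge0// main.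
by rewrite ger0_norm ?subr_ge0 ?(ltW st)// main// ltW.
Qed.

Lemma ucont_bounded_on (J : set R) (f : R -> V) (T : R) :
  is_interval J -> ucont J f -> bounded_on (J `&` [set t | `|t| <= T]) f.
Proof.
move=> Jitv fu; have [C C0 fC] := ucont_linear_growth Jitv fu.
have [[s Js]|J0] := pselect (exists s, J s); last first.
  by exists 0 => t [Jt]; case: J0; exists t.
exists (C * (1 + (T + `|s|)) + rnorm (f s)) => t [Jt /= tT].
rewrite -[f t](subrK (f s)) (le_trans (rnormD _ _))// lerD2r.
rewrite (le_trans (fC _ _ Jt Js))// ler_pM2l// lerD2l.
by rewrite (le_trans (ler_normB _ _))// lerD2r.
Qed.

End Subdivision.

(** * Powers and the complex exponential *)

Section Oscillation.
Context {R : realType}.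
Implicit Types (x y : R).

(** The mean value theorem, with an increasing derivative. *)
Lemma powR_increment (r y x : R) : 1 < r -> 0 < y -> y <= x ->
  r * y `^ (r - 1) * (x - y) <= x `^ r - y `^ r <= r * x `^ (r - 1) * (x - y).
Proof.
move=> r1 y0 yx; have r0 : 0 < r by lra.
have der z : z \in `[y, x] -> is_derive z 1 (fun z : R => z `^ r) (r * z `^ (r - 1)).
  by rewrite in_itv /= => /andP[yz _]; apply: is_derive1_powR; apply: lt_le_trans yz.
have mvt := @MVT_segment R (fun z : R => z `^ r) (fun z => r * z `^ (r - 1)) y x yx.
have [|c ci ->] := mvt (fun z zi => der z (subset_itv_oo_cc zi)).
  by apply: derivable_within_continuous => z /der.
move: ci; rewrite in_itv /= => /andP[yc cx].
have xy0 : 0 <= x - y by rewrite subr_ge0.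
have c0 := lt_le_trans y0 yc.
have [r10 yn cn xn] : [/\ 0 <= r - 1, 0 <= y, 0 <= c & 0 <= x].
  by rewrite subr_ge0 !ltW// (lt_le_trans c0).
by apply/andP; split; apply: ler_wpM2r => //; rewrite ler_pM2l// ge0_ler_powR.
Qed.

Lemma powR_increment0 (r y x : R) : 1 < r -> 0 <= y -> y <= x ->
  x `^ r - y `^ r <= r * x `^ (r - 1) * (x - y).
Proof.
move=> r1; rewrite le_eqVlt => /predU1P[<-|y0] yx; last first.
  by have /andP[] := powR_increment r1 y0 yx.
rewrite powR0 ?gt_eqF ?(lt_trans _ r1)// !subr0 -mulrA [_ * x]mulrC.
by rewrite mulr_powRB1 ?(lt_trans _ r1)// ler_peMl ?powR_ge0// ltW.
Qed.

(** The power z^a lies between 1 and z. *)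
Lemma powR_sublinear (a z : R) : 0 < a <= 1 -> 0 < z -> `|z `^ a - 1| <= `|z - 1|.
Proof.
move=> /andP[a0 a1] z0; case: (leP 1 z) => z1.
  have z1a : 1 <= z `^ a by rewrite -[leLHS](powRr0 z) ler_powR// ltW.
  by rewrite !ger0_norm ?subr_ge0// lerD2r ler1_powR.
have za : z <= z `^ a by rewrite ger1_powR// z0 ltW.
have za1 : z `^ a <= 1 by rewrite -[leRHS](powRr0 z) ger_powR ?z0 ?(ltW z1)// ltW.
rewrite ler0_norm ?subr_le0// ler0_norm ?subr_le0 ?(ltW z1)//; lra.
Qed.

Definition cis x : R[i] := cos x +i* sin x.

Lemma rnorm_cis x : rnorm (cis x) = 1.
Proof. by rewrite rnormE cos2Dsin2 sqrtr1. Qed.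

Lemma cisD x y : cis (x + y) = cis x * cis y.
Proof. by rewrite /cis cosD sinD; apply/eqP; rewrite eq_complex /= [sin x * _ + _]addrC !eqxx. Qed.

Lemma cis_pi : cis pi = -1.
Proof. by rewrite /cis cospi sinpi; apply/eqP; rewrite eq_complex /= oppr0 !eqxx. Qed.

Lemma sin_mvt x y :
  exists2 c, `|c - y| <= `|x - y| & sin x - sin y = cos c * (x - y).
Proof.
have mvt (u v : R) : u <= v -> exists2 c, c \in `[u, v] & sin v - sin u = cos c * (v - u).
  move=> uv; apply: (@MVT_segment R sin cos u v uv).
  by apply: continuous_subspaceT => z; exact: continuous_sin.
case: (leP y x) => [yx|/ltW xy].
  have [c + E] := mvt _ _ yx; rewrite in_itv /= => /andP[yc cx]; exists c => //.
  by rewrite !ger0_norm ?subr_ge0// lerD2r.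
have [c + E] := mvt _ _ xy; rewrite in_itv /= => /andP[xc cy]; exists c.
  by rewrite !ler0_norm ?subr_le0// !opprB lerD2l lerN2.
by rewrite -[LHS]opprB E; ring.
Qed.

Lemma cos_mvt x y :
  exists2 c, `|c - y| <= `|x - y| & cos x - cos y = - sin c * (x - y).
Proof.
have mvt (u v : R) : u <= v -> exists2 c, c \in `[u, v] & cos v - cos u = - sin c * (v - u).
  move=> uv; apply: (@MVT_segment R cos (fun z => - sin z) u v uv).
  by apply: continuous_subspaceT => z; exact: continuous_cos.
case: (leP y x) => [yx|/ltW xy].
  have [c + E] := mvt _ _ yx; rewrite in_itv /= => /andP[yc cx]; exists c => //.
  by rewrite !ger0_norm ?subr_ge0// lerD2r.
have [c + E] := mvt _ _ xy; rewrite in_itv /= => /andP[xc cy]; exists c.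
  by rewrite !ler0_norm ?subr_le0// !opprB lerD2l lerN2.
by rewrite -[LHS]opprB E; ring.
Qed.

Lemma cos_lipschitz x y : `|cos x - cos y| <= `|x - y|.
Proof.
have [c _ ->] := cos_mvt x y.
by rewrite normrM normrN ler_piMl// ler_norml sin_geN1 sin_le1.
Qed.

Lemma sin_lipschitz x y : `|sin x - sin y| <= `|x - y|.
Proof.
have [c _ ->] := sin_mvt x y.
by rewrite normrM ler_piMl// ler_norml cos_geN1 cos_le1.
Qed.

Lemma cis_lipschitz x y : rnorm (cis x - cis y) <= 2 * `|x - y|.
Proof.
rewrite mulr_natl mulr2n (le_trans (rnorm_complex_le _ _))//.
by rewrite lerD ?cos_lipschitz ?sin_lipschitz.
Qed.

Lemma cis_taylor x y :
  rnorm (cis x - cis y - 'i%C * (x - y)%:C * cis y) <= 2 * (x - y) ^+ 2.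
Proof.
suff [hc hs] : `|cos x - cos y + (x - y) * sin y| <= (x - y) ^+ 2 /\
    `|sin x - sin y - (x - y) * cos y| <= (x - y) ^+ 2.
  rewrite (_ : _ - _ = (cos x - cos y + (x - y) * sin y) +i*
      (sin x - sin y - (x - y) * cos y)); last first.
    by apply/eqP; rewrite eq_complex /=; apply/andP; split; apply/eqP; ring.
  rewrite mulr_natl mulr2n (le_trans (rnorm_complex_le _ _))//.
  by rewrite lerD.
split.
  have [c ci ->] := cos_mvt x y.
  rewrite (_ : _ + _ = (sin y - sin c) * (x - y)); last by ring.
  rewrite normrM -[leRHS]ger0_norm ?sqr_ge0// expr2 normrM ler_wpM2r//.
  by rewrite (le_trans (sin_lipschitz _ _))// distrC.
have [c ci ->] := sin_mvt x y.
rewrite (_ : _ - _ = (cos c - cos y) * (x - y)); last by ring.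
rewrite normrM -[leRHS]ger0_norm ?sqr_ge0// expr2 normrM ler_wpM2r//.
by rewrite (le_trans (cos_lipschitz _ _)).
Qed.
End Oscillation.

(** * The oscillating factor *)

Section Phase.
Context {R : realType}.
Variables (omega r : R).
Hypotheses (r1 : 1 < r) (r2 : r <= 2).
Implicit Types (s t T : R).

Let r0 : 0 < r. Proof. exact: lt_trans ltr01 r1. Qed.
Let r10 : 0 < r - 1. Proof. by rewrite subr_gt0. Qed.

Lemma rnorm_g t : rnorm (g omega r t) = 1.
Proof. exact: rnorm_cis. Qed.

Lemma g_neq0 t : g omega r t != 0.
Proof.
apply/negP => /eqP g0; have := rnorm_g t.
by rewrite g0 rnorm0 => /eqP; rewrite eq_sym oner_eq0.
Qed.

(** On [-T, T] the derivative of the phase is at most this in absolute value. *)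
Definition phase_rate T := `|omega| * (r * T `^ (r - 1)).

Lemma phase_rate_ge0 T : 0 <= phase_rate T.
Proof. by rewrite mulr_ge0// mulr_ge0 ?powR_ge0// ltW. Qed.

Lemma phase_lipschitz T s t : `|s| <= T -> `|t| <= T ->
  `|omega * `|s| `^ r - omega * `|t| `^ r| <= phase_rate T * `|s - t|.
Proof.
move=> sT tT; rewrite -mulrBr normrM /phase_rate -[leRHS]mulrA ler_wpM2l//.
wlog st : s t sT tT / `|t| <= `|s| => [hw|].
  have [/hw|/ltW/hw] := leP `|t| `|s|; first exact.
  by rewrite distrC (distrC t); exact.
rewrite ger0_norm; last by rewrite subr_ge0 ge0_ler_powR ?nnegrE// ltW.
rewrite (le_trans (powR_increment0 _ _ st))//.
apply: ler_pM; rewrite ?subr_ge0 ?mulr_ge0 ?powR_ge0 ?(ltW r0)//.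
  by rewrite ler_pM2l// ge0_ler_powR ?nnegrE ?(ltW r10)// (le_trans _ sT).
exact: le_trans (ler_norm _) (ler_dist_dist _ _).
Qed.

Lemma g_lipschitz T s t : `|s| <= T -> `|t| <= T ->
  rnorm (g omega r s - g omega r t) <= 2 * phase_rate T * `|s - t|.
Proof.
move=> sT tT; rewrite (le_trans (cis_lipschitz _ _))// -mulrA ler_pM2l//.
exact: phase_lipschitz.
Qed.

(** The derivative of the phase omega |t|^r at t != 0. *)
Definition dphase t := omega * (r * `|t| `^ (r - 1) * Num.sg t).

Lemma dphase_ratio s t : 0 < s * t ->
  dphase s = dphase t * (`|s| / `|t|) `^ (r - 1).
Proof.
move=> st; have t0 : t != 0 by apply: contraTneq st => ->; rewrite mulr0 ltxx.
have sgE : Num.sg s = Num.sg t.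
  case: (ltgtP t 0) t0 => // t0 _; move: st.
    by rewrite nmulr_lgt0// => s0; rewrite !ltr0_sg.
  by rewrite pmulr_lgt0// => s0; rewrite !gtr0_sg.
rewrite /dphase sgE powRM ?invr_ge0// -powR_inv1// -powRrM mulN1r powRN.
have : `|t| `^ (r - 1) != 0 by rewrite gt_eqF// powR_gt0 ?normr_gt0.
by move: (_ `^ _) => x x0; field.
Qed.

(** The exponent r - 1 is at most 1, and then z^(r - 1) is closer to 1 than z.
    The factor |t| will absorb the linear growth of v. *)
Lemma dphase_ratio_le s t : 0 < s * t ->
  `|1 - (`|s| / `|t|) `^ (r - 1)| * `|t| <= `|s - t| .
Proof.
move=> st; have s0 : 0 < `|s|.
  by rewrite normr_gt0; apply: contraTneq st => ->; rewrite mul0r ltxx.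
have t0 : 0 < `|t|.
  by rewrite normr_gt0; apply: contraTneq st => ->; rewrite mulr0 ltxx.
apply: le_trans (ler_dist_dist _ _).
rewrite distrC (_ : `|s| - `|t| = (`|s| / `|t| - 1) * `|t|); last first.
  by rewrite mulrBl divfK ?gt_eqF// mul1r.
rewrite normrM normr_id ler_wpM2r// powR_sublinear ?divr_gt0//.
by rewrite r10 /= lerBlDr.
Qed.

(** Both sides of powR_increment differ by the increment of z^(r - 1), which is
    Lipschitz away from 0. The singularity of the second derivative at 0 for
    r < 2 is why the arguments stay above 1. *)
Lemma powR_taylor (T x y : R) : 1 <= x <= T -> 1 <= y <= T ->
  `|x `^ r - y `^ r - r * y `^ (r - 1) * (x - y)| <=
    r * T `^ (r - 1) * (x - y) ^+ 2.
Proof.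
move=> /andP[x1 xT] /andP[y1 yT].
have [x0 y0] : 0 < x /\ 0 < y by split; lra.
apply: (@le_trans _ _ (r * `|x `^ (r - 1) - y `^ (r - 1)| * `|x - y|)).
  have [yx|/ltW xy] := leP y x.
    have /andP[lo hi] := powR_increment r1 y0 yx.
    have mono : y `^ (r - 1) <= x `^ (r - 1).
      by rewrite ge0_ler_powR// ?nnegrE ltW.
    rewrite !ger0_norm ?subr_ge0//; nra.
  have /andP[lo hi] := powR_increment r1 x0 xy.
  have mono : x `^ (r - 1) <= y `^ (r - 1).
    by rewrite ge0_ler_powR// ?nnegrE ltW.
  rewrite ger0_norm; last nra.
  rewrite ler0_norm ?subr_le0// ler0_norm ?subr_le0//; nra.
rewrite -[leRHS]ger0_norm; last by rewrite mulr_ge0 ?sqr_ge0// mulr_ge0 ?powR_ge0 ?(ltW r0).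
rewrite expr2 mulrA normrM ler_wpM2r// -!mulrA !normrM (ger0_norm (ltW r0)).
rewrite ler_pM2l// ger0_norm ?powR_ge0//.
have -> : x `^ (r - 1) - y `^ (r - 1) = y `^ (r - 1) * ((x / y) `^ (r - 1) - 1).
  rewrite mulrBr mulr1 -powRM ?divr_ge0 ?(ltW x0) ?(ltW y0)//.
  by rewrite mulrC divfK ?gt_eqF.
rewrite normrM ger0_norm ?powR_ge0// ler_pM ?powR_ge0//.
  by rewrite ge0_ler_powR ?nnegrE ?(ltW r10) ?(ltW y0) ?(le_trans (ltW y0)).
have r12 : 0 < r - 1 <= 1 by rewrite r10 lerBlDr.
rewrite (le_trans (powR_sublinear r12 _)) ?divr_gt0//.
rewrite (_ : x / y - 1 = (x - y) / y); last by rewrite mulrBl divff ?gt_eqF.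
by rewrite normrM ler_piMr// normfV ger0_norm ?(ltW y0)// invf_le1.
Qed.

Lemma phase_taylor T s t : 1 <= `|s| <= T -> 1 <= `|t| <= T -> 0 < s * t ->
  `|omega * `|s| `^ r - omega * `|t| `^ r - dphase t * (s - t)| <=
    phase_rate T * (s - t) ^+ 2.
Proof.
move=> sT tT st.
have stE : `|s| - `|t| = Num.sg t * (s - t).
  have t0 : t != 0 by apply: contraTneq st => ->; rewrite mulr0 ltxx.
  case: (ltgtP t 0) t0 => // t0 _; move: st.
    rewrite nmulr_lgt0// => s0.
    by rewrite !ltr0_norm// ltr0_sg// mulN1r opprD.
  by rewrite pmulr_lgt0// => s0; rewrite !gtr0_norm// gtr0_sg// mul1r.
have stE2 : (s - t) ^+ 2 = (`|s| - `|t|) ^+ 2.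
  rewrite stE exprMn sqr_sg (_ : t != 0) ?mul1r//.
  by apply: contraTneq st => ->; rewrite mulr0 ltxx.
rewrite stE2 /phase_rate -mulrA (_ : _ - _ = omega *
    (`|s| `^ r - `|t| `^ r - r * `|t| `^ (r - 1) * (`|s| - `|t|))); last first.
  by rewrite stE /dphase; ring.
by rewrite normrM ler_wpM2l// powR_taylor.
Qed.

Lemma g_taylor T s t : 1 <= `|s| <= T -> 1 <= `|t| <= T -> 0 < s * t ->
  rnorm (g omega r s - g omega r t - 'i%C * (dphase t * (s - t))%:C * g omega r t) <=
    (phase_rate T + 2 * phase_rate T ^+ 2) * (s - t) ^+ 2.
Proof.
move=> s1T t1T st; have [/andP[_ sT] /andP[_ tT]] := (s1T, t1T).
set p := omega * `|s| `^ r; set q := omega * `|t| `^ r.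
rewrite (_ : _ - _ = (cis p - cis q - 'i%C * (p - q)%:C * cis q) +
   'i%C * (p - q - dphase t * (s - t))%:C * cis q); last first.
  rewrite /g -/(cis p) -/(cis q) -/p -/q; rewrite !rmorphB /=; ring.
rewrite (le_trans (rnormD _ _))// addrC mulrDl lerD//.
  rewrite !rnormM rnorm_cis rnorm_real mulr1.
  have -> : rnorm ('i%C : R[i]) = 1 by rewrite rnormE expr0n expr1n add0r sqrtr1.
  by rewrite mul1r phase_taylor.
rewrite (le_trans (cis_taylor _ _))// -mulrA ler_pM2l// -exprMn.
rewrite -[leLHS]real_normK ?num_real// -[leRHS]real_normK ?num_real//.
rewrite ler_pXn2r ?nnegrE// (le_trans (phase_lipschitz sT tT))//.
by rewrite normrM (ger0_norm (phase_rate_ge0 T)).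
Qed.

End Phase.

(** * Points in opposite phase *)

Section Antiphase.
Context {R : realType}.
Variables (omega r : R).
Hypotheses (omega0 : omega != 0) (r1 : 1 < r).
Implicit Types (s t T : R).

Let r0 : 0 < r. Proof. exact: lt_trans ltr01 r1. Qed.
Let r10 : 0 < r - 1. Proof. by rewrite subr_gt0. Qed.
Let c := pi / `|omega|.
Let c0 : 0 < c. Proof. by rewrite divr_gt0 ?pi_gt0 ?normr_gt0. Qed.

(** On an interval bounded below by a number the map must move to the right in
    order to stay in J, and only large positive t matter; the last condition is
    therefore restricted to J. *)
Definition antiphase_map (J : set R) (theta : R -> R) :=
  [/\ forall t, J t -> J (theta t),
      forall T, exists2 C : R, 0 <= C & forall s t, `|s| <= T -> `|t| <= T ->
        `|theta s - theta t| <= C * `|s - t| &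
      forall d : R, 0 < d -> exists T, forall t, J t -> T <= `|t| ->
        `|theta t - t| < d /\ g omega r (theta t) = - g omega r t].

(** The solution A t of A t^r = |t|^r + pi / |omega| is at distance pi in phase
    from t. *)
Lemma antiphase_exists : exists A : R -> R, exists2 b, 0 < b &
  [/\ forall t, A t `^ r = `|t| `^ r + c, forall t, b <= A t,
      forall t, `|t| <= A t & forall s t, `|s| <= `|t| -> A s <= A t].
Proof.
exists (fun t => (`|t| `^ r + c) `^ r^-1), (c `^ r^-1); first by rewrite powR_gt0.
have Pn t : 0 <= `|t| `^ r by rewrite powR_ge0.
have Pc t : 0 <= `|t| `^ r + c by rewrite addr_ge0 ?(ltW c0).
have root_mono x y : 0 <= x -> x <= y -> x `^ r^-1 <= y `^ r^-1.
  move=> x0 xy; apply: ge0_ler_powR; rewrite ?nnegrE ?invr_ge0 ?(ltW r0)//.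
  exact: le_trans xy.
split=> [t|t|t|s t st].
- by rewrite -powRrM mulVf ?gt_eqF// powRr1.
- by apply: root_mono; rewrite ?(ltW c0) ?lerDr.
- rewrite -[leLHS]powRr1// -[X in _ `^ X](@divff _ r) ?gt_eqF// powRrM.
  by apply: root_mono; rewrite ?lerDl ?(ltW c0).
- apply: root_mono => //; rewrite lerD2r.
  by apply: ge0_ler_powR; rewrite ?nnegrE ?(ltW r0).
Qed.

Variables (A : R -> R) (b : R).
Hypotheses (b0 : 0 < b) (A_powR : forall t, A t `^ r = `|t| `^ r + c).
Hypotheses (A_min : forall t, b <= A t) (ge_A : forall t, `|t| <= A t).
Hypotheses (A_mono : forall s t, `|s| <= `|t| -> A s <= A t).

Let A_gt0 t : 0 < A t. Proof. exact: lt_le_trans b0 (A_min t). Qed.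

Lemma g_antiphase s t : `|s| = A t -> g omega r s = - g omega r t.
Proof.
move=> st; rewrite /g st A_powR mulrDr -/(cis _) -/(cis (_ * _)) cisD.
suff -> : cis (omega * c) = -1 by rewrite mulrN1.
have {st} : omega * c = pi \/ omega * c = - pi.
  rewrite /c mulrCA; have [w0|w0] := ltP omega 0; [right|left].
    by rewrite ltr0_norm// invrN mulrN divff ?ltr0_neq0// mulrN1.
  by rewrite ger0_norm// divff ?mulr1.
move=> [->|->]; first exact: cis_pi.
by rewrite /cis cosN sinN cospi sinpi; apply/eqP; rewrite eq_complex /= !oppr0 !eqxx.
Qed.

Lemma powR_unbounded M : exists2 T, 0 < T & forall t, T <= t -> M <= t `^ (r - 1).
Proof.
exists ((`|M| + 1) `^ (r - 1)^-1); first by rewrite powR_gt0// ltr_wpDl.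
move=> t Tt; apply: (@le_trans _ _ (`|M| + 1)); first by rewrite ler_wpDr// ler_norm.
have -> : `|M| + 1 = ((`|M| + 1) `^ (r - 1)^-1) `^ (r - 1).
  by rewrite -powRrM mulVf ?gt_eqF// powRr1// addr_ge0.
by rewrite ge0_ler_powR ?nnegrE ?powR_ge0 ?(ltW r10)// (le_trans _ Tt) ?powR_ge0.
Qed.

(** The slope r |t|^(r - 1) of the phase is unbounded as r > 1. *)
Lemma antiphase_close d : 0 < d -> exists T, forall t, T <= `|t| -> A t - `|t| < d.
Proof.
move=> d0; have [T T0 hT] := powR_unbounded (c / (r * d) + 1).
exists T => t Tt; have t0 := lt_le_trans T0 Tt.
have /andP[lo _] := powR_increment r1 t0 (ge_A t).
move: lo; rewrite A_powR addrAC subrr add0r => lo.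
have := hT _ Tt; set P := `|t| `^ _ in lo *.
move=> PT; have P0 : 0 < P by rewrite powR_gt0.
rewrite -(ltr_pM2l (_ : 0 < r * P)) ?mulr_gt0// (le_lt_trans lo)//.
rewrite mulrAC -ltr_pdivrMl ?mulr_gt0// mulrC (lt_le_trans _ PT)//.
by rewrite ltrDl.
Qed.

Lemma antiphase_lipschitz T : exists2 C, 0 <= C & forall s t, `|s| <= T -> `|t| <= T ->
  `|A s - A t| <= C * `|s - t|.
Proof.
exists (T `^ (r - 1) / b `^ (r - 1)); first by rewrite divr_ge0 ?powR_ge0.
move=> s t; wlog st : s t / `|t| <= `|s| => [hw|] sT tT.
  have [/hw|/ltW/hw] := leP `|t| `|s|; first exact.
  by move=> h; rewrite (distrC (A s)) (distrC s) h.
rewrite ger0_norm ?subr_ge0 ?A_mono// mulrAC ler_pdivlMr ?powR_gt0//.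
have /andP[lo _] := powR_increment r1 (A_gt0 t) (A_mono st).
have hi := powR_increment0 r1 (normr_ge0 t) st.
rewrite -(ler_pM2l r0).
apply: (@le_trans _ _ (r * A t `^ (r - 1) * (A s - A t))).
  rewrite -[leRHS]mulrA ler_pM2l// [leLHS]mulrC ler_wpM2r ?subr_ge0 ?A_mono//.
  by apply: ge0_ler_powR; rewrite ?nnegrE; [exact: ltW|exact: ltW|exact: ltW|].
apply: (le_trans lo); rewrite !A_powR opprD addrACA subrr addr0.
rewrite (le_trans hi)// -mulrA ler_pM2l// ler_pM ?powR_ge0 ?subr_ge0//.
  by apply: ge0_ler_powR; rewrite ?nnegrE ?(ltW r10)// (le_trans _ sT).
exact: le_trans (ler_norm _) (ler_dist_dist _ _).
Qed.

(** A continuous substitute for the sign: on the whole line, the shift is applied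
    to |t| and the sign restored, which would jump at 0. *)
Definition clamp t := Num.max (-1) (Num.min 1 t).

Lemma clamp_lipschitz s t : `|clamp s - clamp t| <= `|s - t|.
Proof.
rewrite /clamp /Num.max /Num.min.
case: (ltP 1 s) => ?; case: (ltP 1 t) => ?; repeat case: ifP => /= ?; try lra.
all: rewrite ler_norml; apply/andP; split;
  (have := ler_norm (s - t)); (have := ler_norm (- (s - t))); rewrite normrN; lra.
Qed.

Lemma clamp_le1 t : `|clamp t| <= 1.
Proof.
rewrite /clamp /Num.max /Num.min ler_norml.
by case: (ltP 1 t) => ?; case: ifP => /= ?; lra.
Qed.

Lemma clamp_sg t : 1 <= `|t| -> clamp t = Num.sg t.
Proof.
rewrite /clamp /Num.max /Num.min; case: (sgrP t) => [->|t0|t0]; rewrite ?normr0 ?ler10//.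
  by move=> t1; repeat case: ifPn; lra.
by move=> t1; repeat case: ifPn; lra.
Qed.

Lemma antiphase_map_construction (J : set R) : unbounded_right_interval J ->
  exists theta, antiphase_map J theta.
Proof.
move=> HJ.
have half a K : (forall t, K t -> a <= t) -> (forall s t, K s -> s <= t -> K t) ->
    exists theta, antiphase_map K theta.
  move=> Ja Jup; exists A; split.
  - move=> t Jt; apply: (Jup t) => //.
    exact: le_trans (ler_norm t) (ge_A t).
  - exact: antiphase_lipschitz.
  - move=> d d0; have [T hT] := antiphase_close d0.
    exists (Num.max T (`|a| + 1)) => t Jt; rewrite ge_max => /andP[Tt at1].
    have t0 : 0 <= t.
      rewrite leNgt; apply/negP => t0; have := Ja _ Jt.
      by move: at1; rewrite (ltr0_norm t0); have := ler_norm (- a); rewrite normrN; lra.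
    split; last by apply: g_antiphase; rewrite ger0_norm// ltW// A_gt0.
    have := hT _ Tt; have := ge_A t; rewrite (ger0_norm t0) => tA.
    by rewrite ger0_norm ?subr_ge0.
case: HJ => [[a ->]|[a ->]|->].
- apply: (half a); first by move=> t; rewrite /= in_itv /= andbT.
  by move=> s t; rewrite /= !in_itv /= !andbT; exact: le_trans.
- apply: (half a); first by move=> t; rewrite /= in_itv /= andbT => /ltW.
  by move=> s t; rewrite /= !in_itv /= !andbT; exact: lt_le_trans.
exists (fun t => A t * clamp t); split => //.
- move=> T; have [C C0 hC] := antiphase_lipschitz T.
  exists (A T + C); first by rewrite addr_ge0// ltW// A_gt0.
  move=> s t sT tT.
  have -> : A s * clamp s - A t * clamp t =
      A s * (clamp s - clamp t) + (A s - A t) * clamp t.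
    by move: (A s) (A t) (clamp s) (clamp t) => *; ring.
  rewrite (le_trans (ler_normD _ _))// !normrM mulrDl lerD//.
    rewrite ler_pM ?clamp_lipschitz// ger0_norm ?(ltW (A_gt0 s))// A_mono//.
    exact: le_trans sT (ler_norm _).
  by rewrite (le_trans _ (hC _ _ sT tT))// ler_piMr ?clamp_le1.
- move=> d d0; have [T hT] := antiphase_close d0.
  exists (Num.max T 1) => t _; rewrite ge_max => /andP[/hT ad t1].
  have t0 : t != 0 by rewrite -normr_gt0 (lt_le_trans ltr01).
  rewrite (clamp_sg t1); split.
    rewrite -[X in _ - X]mulr_sg_norm (mulrC (A t)) -mulrBr normrM normr_sg t0 mul1r.
    by rewrite ger0_norm// subr_ge0 ge_A.
  apply: g_antiphase; rewrite normrM normr_sg t0 mulr1.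
  by rewrite ger0_norm// ltW// A_gt0.
Qed.

End Antiphase.

Lemma antiphase_map_exists {R : realType} (omega r : R) (J : set R) :
  omega != 0 -> 1 < r -> unbounded_right_interval J ->
  exists theta, antiphase_map omega r J theta.
Proof.
move=> w0 r1 HJ; have [A [b b0 [? ? ? ?]]] := antiphase_exists w0 r1.
exact: (@antiphase_map_construction R omega r w0 r1 A b).
Qed.

(** * The alternating form *)

Section UcontOperations.
Context {R : realType}.

Lemma ucont_lipschitz (V : normedZmodType R[i]) (K : set R) (f : R -> V) (C : R) :
  (forall s t, K s -> K t -> rnorm (f s - f t) <= C * `|s - t|) -> ucont K f.
Proof.
move=> fC e e0; have C1 : 0 < `|C| + 1 by rewrite ltr_wpDl.
exists (e / (`|C| + 1)) => [|s t Ks Kt]; first exact: divr_gt0.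
rewrite ltr_pdivlMr// => st; apply: le_lt_trans st.
rewrite (le_trans (fC _ _ Ks Kt))// mulrC ler_wpM2l// ler_wpDr//.
exact: ler_norm.
Qed.

Lemma sub_ucont (V : normedZmodType R[i]) (K L : set R) (f : R -> V) :
  K `<=` L -> ucont L f -> ucont K f.
Proof.
by move=> KL fu e /fu[d d0 fd]; exists d => // s t /KL Ks /KL Kt; exact: fd.
Qed.

Lemma eq_ucont (V : normedZmodType R[i]) (K : set R) (f h : R -> V) :
  (forall t, K t -> f t = h t) -> ucont K f -> ucont K h.
Proof.
move=> fh fu e /fu[d d0 fd]; exists d => // s t Ks Kt st.
by rewrite -!fh// fd.
Qed.

Lemma ucontD (V : normedZmodType R[i]) (K : set R) (f h : R -> V) :
  ucont K f -> ucont K h -> ucont K (fun t => f t + h t).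
Proof.
move=> fu hu e e0; have e20 : 0 < e / 2 by rewrite divr_gt0.
have [d d0 fd] := fu _ e20; have [d' d'0 hd] := hu _ e20.
exists (Num.min d d') => [|s t Ks Kt]; first by rewrite lt_min d0.
rewrite lt_min => /andP[st st']; rewrite opprD addrACA (splitr e).
by rewrite (le_lt_trans (rnormD _ _))// ltrD ?fd ?hd.
Qed.

Lemma ucontN (V : normedZmodType R[i]) (K : set R) (f : R -> V) :
  ucont K f -> ucont K (fun t => - f t).
Proof.
move=> fu e /fu[d d0 fd]; exists d => // s t Ks Kt st.
by rewrite -opprD rnormN fd.
Qed.

Lemma ucontZ (V : normedModType R[i]) (K : set R) (c : R -> R[i]) (f : R -> V) :
  ucont K c -> bounded_on K c -> ucont K f -> bounded_on K f ->
  ucont K (fun t => c t *: f t).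
Proof.
move=> cu [C cC] fu [M fM] e e0.
have C1 : 0 < `|C| + 1 by rewrite ltr_wpDl.
have M1 : 0 < `|M| + 1 by rewrite ltr_wpDl.
have [d d0 fd] := fu (e / 2 / (`|C| + 1)) (divr_gt0 (divr_gt0 e0 (ltr0Sn _ _)) C1).
have [d' d'0 cd] := cu (e / 2 / (`|M| + 1)) (divr_gt0 (divr_gt0 e0 (ltr0Sn _ _)) M1).
exists (Num.min d d') => [|s t Ks Kt]; first by rewrite lt_min d0.
rewrite lt_min => /andP[st st'].
have -> : c s *: f s - c t *: f t = c s *: (f s - f t) + (c s - c t) *: f t.
  by rewrite scalerBr scalerBl addrA subrK.
rewrite (splitr e) (le_lt_trans (rnormD _ _))// !rnormZ ltrD//.
  have := fd _ _ Ks Kt st; rewrite ltr_pdivlMr// => h.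
  rewrite (le_lt_trans _ h)// mulrC ler_wpM2l ?rnorm_ge0//.
  by rewrite (le_trans (cC _ Ks))// ler_wpDr// ler_norm.
have := cd _ _ Ks Kt st'; rewrite ltr_pdivlMr// => h.
rewrite (le_lt_trans _ h)// ler_wpM2l ?rnorm_ge0//.
by rewrite (le_trans (fM _ Kt))// ler_wpDr// ler_norm.
Qed.

Lemma ucont_comp (V : normedZmodType R[i]) (K L : set R) (theta : R -> R)
    (C : R) (f : R -> V) : (forall t, K t -> L (theta t)) ->
  (forall s t, K s -> K t -> `|theta s - theta t| <= C * `|s - t|) ->
  ucont L f -> ucont K (fun t => f (theta t)).
Proof.
move=> KL thetaC fu e /fu[d d0 fd]; have C1 : 0 < `|C| + 1 by rewrite ltr_wpDl.
exists (d / (`|C| + 1)) => [|s t Ks Kt]; first exact: divr_gt0.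
rewrite ltr_pdivlMr// => st; apply: fd; [exact: KL|exact: KL|]; apply: le_lt_trans st.
rewrite (le_trans (thetaC _ _ Ks Kt))// mulrC ler_wpM2l// ler_wpDr//.
exact: ler_norm.
Qed.

Lemma bounded_onB (V : normedZmodType R[i]) (K : set R) (f h : R -> V) :
  bounded_on K f -> bounded_on K h -> bounded_on K (fun t => f t - h t).
Proof.
move=> [C fC] [D hD]; exists (C + D) => t Kt.
by rewrite (le_trans (rnormB _ _))// lerD ?fC ?hD.
Qed.

End UcontOperations.

Section AlternatingForm.
Context {R : realType} {X : completeNormedModType R[i]}.
Variables (omega r : R).
Local Notation g := (g omega r).
Implicit Types (J : set R) (f u v : R -> X).

(** The determinant with rows (1, 1, 1), (g s1, g s2, g s3), (f s1, f s2, f s3). *)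
Definition altg f (s1 s2 s3 : R) : X :=
  (g s3 - g s1) *: (f s2 - f s1) + (g s1 - g s2) *: (f s3 - f s1).

(** On short intervals f is close to the span of 1 and g, uniformly in position. *)
Definition locally_span1g J f := forall e : R, 0 < e -> exists2 d : R, 0 < d &
  forall s1 s2 s3, J s1 -> J s2 -> J s3 -> `|s2 - s1| < d -> `|s3 - s1| < d ->
  rnorm (altg f s1 s2 s3) < e.

Lemma rnorm_gB s t : rnorm (g s - g t) <= 2.
Proof. by rewrite (le_trans (rnormB _ _))// !rnorm_g. Qed.

Lemma lincomb_cancel (c2 c3 k2 k3 : R[i]) (a2 a3 d : X) :
  c2 * k2 + c3 * k3 = 0 ->
  c2 *: (a2 + k2 *: d) + c3 *: (a3 + k3 *: d) = c2 *: a2 + c3 *: a3.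
Proof.
by move=> ck; rewrite !scalerDr !scalerA addrACA -scalerDl ck scale0r addr0.
Qed.

(** Increments of f may be changed by a common multiple of those of g. *)
Lemma altg_cancel f s1 s2 s3 (a2 a3 d : X) :
  f s2 - f s1 = a2 + (g s2 - g s1) *: d -> f s3 - f s1 = a3 + (g s3 - g s1) *: d ->
  altg f s1 s2 s3 = (g s3 - g s1) *: a2 + (g s1 - g s2) *: a3.
Proof. by move=> f2 f3; rewrite /altg f2 f3; apply: lincomb_cancel; ring. Qed.

Lemma rnorm_altg_lt (a2 a3 : X) (e : R) s1 s2 s3 :
  rnorm a2 < e / 4 -> rnorm a3 < e / 4 ->
  rnorm ((g s3 - g s1) *: a2 + (g s1 - g s2) *: a3) < e.
Proof.
have small (c : R[i]) (a : X) : rnorm c <= 2 -> rnorm a < e / 4 -> rnorm (c *: a) < e / 2.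
  move=> c2 ae; rewrite rnormZ; apply: (@le_lt_trans _ _ (2 * rnorm a)); last lra.
  by rewrite ler_wpM2r ?rnorm_ge0.
move=> a2e a3e; rewrite (splitr e) (le_lt_trans (rnormD _ _))//.
by rewrite ltrD// small// rnorm_gB.
Qed.

(** Freezing v at s1, the increment of u + g v is that of u, plus g times that of
    v, plus a multiple of the increment of g that the form does not see. *)
Lemma sum_mul_locally_span1g J f u v : ucont J u -> ucont J v ->
  (forall t, J t -> f t = u t + g t *: v t) -> locally_span1g J f.
Proof.
move=> uu vu fE e e0; have e80 : 0 < e / 8 by rewrite divr_gt0.
have [d d0 ud] := uu _ e80; have [d' d'0 vd] := vu _ e80.
exists (Num.min d d') => [|s1 s2 s3 J1 J2 J3]; first by rewrite lt_min d0.
rewrite !lt_min => /andP[s12 s12'] /andP[s13 s13'].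
have incr s : J s -> f s - f s1 =
    (u s - u s1 + g s *: (v s - v s1)) + (g s - g s1) *: v s1.
  move=> Js; rewrite !fE// opprD addrACA -[RHS]addrA; congr (_ + _).
  by rewrite scalerBr scalerBl addrA subrK.
rewrite (altg_cancel (incr _ J2) (incr _ J3)).
have small s : J s -> `|s - s1| < d -> `|s - s1| < d' ->
    rnorm (u s - u s1 + g s *: (v s - v s1)) < e / 4.
  move=> Js sd sd'; rewrite (le_lt_trans (rnormD _ _))// rnormZ rnorm_g mul1r.
  have := ud _ _ Js J1 sd; have := vd _ _ Js J1 sd'.
  by move: (rnorm _) (rnorm _) => *; lra.
by apply: rnorm_altg_lt; exact: small.
Qed.

Lemma scaler_half (a b : X) : 2^-1 *: (a + b) + 2^-1 *: (a - b) = a.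
Proof.
by rewrite -scalerDr addrACA subrr addr0 -[a + a]mulr2n -[a *+ 2]scaler_nat scalerA mulVf ?scale1r// pnatr_eq0.
Qed.

(** At two points in opposite phase, f determines the constants u t and v t; the
    form on (t, t', s) then measures how well u t + g v t predicts f s. *)
Lemma locally_span1g_reconstruct u v (f : R -> X) t t' s :
  g t' = - g t -> f t = u t + g t *: v t -> f t' = u t - g t *: v t ->
  rnorm (f s - (u t + g s *: v t)) = 2^-1 * rnorm (altg f t t' s).
Proof.
move=> gt' ft ft'.
have -> : altg f t t' s = (2 * g t) *: (f s - (u t + g s *: v t)).
  rewrite /altg gt' opprK ft ft' (_ : g t + g t = 2 * g t); last by rewrite mulr_natl mulr2n.
  have -> : u t - g t *: v t - (u t + g t *: v t) = - ((2 * g t) *: v t).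
    by rewrite opprD addrACA subrr add0r -opprD mulr_natl mulr2n scalerDl.
  have -> : (g s - g t) *: - ((2 * g t) *: v t) = (2 * g t) *: - ((g s - g t) *: v t).
    by rewrite !scalerN !scalerA [_ * (2 * _)]mulrC.
  rewrite -scalerDr addrC; congr (_ *: _).
  by rewrite scalerBl opprB opprD -!addrA (addrA (- (g t *: _))) addNr add0r opprD.
by rewrite rnormZ rnormM rnorm_g mulr1 rnorm_nat mulKf ?pnatr_eq0.
Qed.

End AlternatingForm.

(** * The decomposition criterion *)

Section Interval.
Context {R : realType}.
Variables (J : set R).
Hypothesis (HJ : unbounded_right_interval J).

Lemma unbounded_right_up s t : J s -> s <= t -> J t.
Proof.
case: HJ => [[a ->]|[a ->]|->//]; rewrite /= !in_itv /= !andbT.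
  exact: le_trans.
exact: lt_le_trans.
Qed.

Lemma unbounded_right_is_interval : is_interval J.
Proof. by move=> s t Js _ x /andP[sx _]; exact: unbounded_right_up sx. Qed.

End Interval.

Section Structure.
Context {R : realType} {X : completeNormedModType R[i]}.
Variables (omega r : R).
Hypotheses (omega0 : omega != 0) (r1 : 1 < r).
Local Notation g := (g omega r).
Variables (J : set R).
Hypothesis (HJ : unbounded_right_interval J).

Lemma ucont_far_near (u : R -> X) :
  (forall T, ucont (J `&` [set t | `|t| <= T]) u) ->
  (forall e : R, 0 < e -> exists T, exists2 d : R, 0 < d & forall s t, J s -> J t ->
     T <= `|s| -> T <= `|t| -> `|s - t| < d -> rnorm (u s - u t) < e) ->
  ucont J u.
Proof.
move=> near far e e0; have [T [d d0 fard]] := far _ e0.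
have [d' d'0 neard] := near (T + 1) _ e0.
exists (Num.min (Num.min d d') 1) => [|s t Js Jt]; first by rewrite !lt_min d0 d'0 ltr01.
rewrite !lt_min => /andP[/andP[st st'] st1].
have le_T1 x y : `|x - y| < 1 -> `|y| < T -> `|x| <= T + 1.
  move=> xy yT; rewrite -(subrK y x) addrC (le_trans (ler_normD _ _))//.
  by rewrite lerD// ltW.
have sub x : `|x| < T -> `|x| <= T + 1 by move=> xT; rewrite ler_wpDr// ltW.
have [Ts|sT] := leP T `|s|; last first.
  by apply: neard => //; split => //=; [exact: sub|apply: le_T1 sT; rewrite distrC].
have [Tt|tT] := leP T `|t|; first exact: fard.
by apply: neard => //; split => //=; [exact: le_T1 tT|exact: sub].
Qed.

Lemma midpoint_sub (a b c w : X) :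
  2^-1 *: (a + b) - c = 2^-1 *: ((a - (c + w)) + (b - (c - w))).
Proof.
rewrite addrACA -opprD (addrACA c w) subrr addr0 scalerBr; congr (_ - _).
by rewrite -[LHS](scaler_half _ c) subrr scaler0 addr0.
Qed.

Lemma midpoint_diff (a b c w : X) :
  2^-1 *: (a - b) - w = 2^-1 *: ((a - (c + w)) + - (b - (c - w))).
Proof.
rewrite (midpoint_sub _ _ _ c) (addrC w c); congr (_ *: (_ + _)).
by rewrite !opprB addrC.
Qed.

(** The two unknowns u t and v t are solved from the values of f at t and at the
    nearby point theta t in opposite phase. *)
Theorem bounded_decomposition (f : R -> X) : bounded_on J f ->
  (forall T, ucont (J `&` [set t | `|t| <= T]) f) ->
  locally_span1g omega r J f -> sum_mul J g (BUC J) (BUC J) f.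
Proof.
move=> [M fM] fnear fspan.
have [theta [thetaJ theta_lip theta_far]] := antiphase_map_exists omega0 r1 HJ.
pose u := fun t => 2^-1 *: (f t + f (theta t)).
pose v := fun t => (2 * g t)^-1 *: (f t - f (theta t)).
have gv t : g t *: v t = 2^-1 *: (f t - f (theta t)).
  by rewrite /v scalerA invfM mulrCA divff ?g_neq0 ?mulr1.
have fuv t : f t = u t + g t *: v t by rewrite gv scaler_half.
have fuv' t : f (theta t) = u t - g t *: v t.
  rewrite gv -scalerN opprB -[LHS](scaler_half _ (f t)).
  by rewrite [f (theta t) + _]addrC.
have n2 : rnorm (2^-1 : R[i]) = 2^-1 by rewrite rnormV rnorm_nat.
have uM : bounded_on J u.
  exists M => t Jt; rewrite rnormZ n2 ler_pdivrMl// mulr_natl mulr2n.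
  by rewrite (le_trans (rnormD _ _))// lerD ?fM//; exact: thetaJ.
have vM : bounded_on J v.
  exists M => t Jt; rewrite -[leLHS]mul1r -(rnorm_g omega r t) -rnormZ gv.
  rewrite rnormZ n2 ler_pdivrMl// mulr_natl mulr2n.
  by rewrite (le_trans (rnormB _ _))// lerD ?fM//; exact: thetaJ.
have far e : 0 < e -> exists T, exists2 d : R, 0 < d & forall s t, J s -> J t ->
     T <= `|s| -> T <= `|t| -> `|s - t| < d -> rnorm (u s - u t) < e /\ rnorm (v s - v t) < e.
  move=> e0; have [d d0 fd] := fspan _ e0.
  have d20 : 0 < d / 2 by rewrite divr_gt0.
  have [T hT] := theta_far _ d20.
  exists T, (d / 2) => // s t Js Jt Ts Tt st.
  have [thetat gt] := hT _ Jt Tt; have [thetas gs] := hT _ Js Ts.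
  (* the constants u t and v t predict f at s and at theta s *)
  have E1 : rnorm (f s - (u t + g s *: v t)) < e / 2.
    rewrite (locally_span1g_reconstruct _ gt) // mulrC ltr_pM2r ?invr_gt0//.
    by apply: fd => //; [exact: thetaJ|lra|lra].
  have E2 : rnorm (f (theta s) - (u t - g s *: v t)) < e / 2.
    have := locally_span1g_reconstruct (theta s) gt (fuv t) (fuv' t).
    rewrite gs scaleNr => ->; rewrite mulrC ltr_pM2r ?invr_gt0//.
    apply: fd => //; [exact: thetaJ|exact: thetaJ|lra|].
    by rewrite (le_lt_trans (ler_distD s _ _))//; lra.
  have half2 (a b : X) : rnorm a < e / 2 -> rnorm b < e / 2 ->
      rnorm (2^-1 *: (a + b)) < e.
    move=> ae be; rewrite rnormZ n2 ltr_pdivrMl// mulr_natl mulr2n.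
    rewrite (le_lt_trans (rnormD _ _))// (lt_le_trans (ltrD ae be))// -splitr.
    by rewrite lerDl ltW.
  split; first by rewrite (midpoint_sub _ _ _ (g s *: v t)) half2.
  rewrite -[ltLHS]mul1r -(rnorm_g omega r s) -rnormZ scalerBr gv.
  by rewrite (midpoint_diff _ _ (u t)) half2// rnormN.
have near T : ucont (J `&` [set t | `|t| <= T]) u /\ ucont (J `&` [set t | `|t| <= T]) v.
  set K := J `&` _; have [C C0 hC] := theta_lip `|T|.
  have KT t : K t -> `|t| <= `|T| by move=> [_ /= tT]; rewrite (le_trans tT)// ler_norm.
  have fK : ucont K f := fnear T.
  have fthetaK : ucont K (fun t => f (theta t)).
    apply: (@ucont_comp _ _ K (J `&` [set t | `|t| <= `|theta 0| + C * `|T|]) _ C) => //.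
      move=> t Kt; split; first by apply: thetaJ; case: Kt.
      rewrite /= -[theta t](subrK (theta 0)) addrC (le_trans (ler_normD _ _))// lerD2l.
      rewrite (le_trans (hC _ _ (KT _ Kt) _)) ?normr0// subr0 ler_wpM2l//.
      exact: KT.
    by move=> s t /KT sT /KT tT; exact: hC.
  have bK : bounded_on K f by exists M => t [Jt _]; exact: fM.
  have bthetaK : bounded_on K (fun t => f (theta t)).
    by exists M => t [Jt _]; exact/fM/thetaJ.
  have [D fD] : bounded_on K (fun t => f t + f (theta t)).
    by exists (M + M) => t [Jt _]; rewrite (le_trans (rnormD _ _))// lerD ?fM//; exact: thetaJ.
  split.
    apply: ucontZ; [|by exists 2^-1 => t _; rewrite n2|exact: ucontD|by exists D].
    by apply: (@ucont_lipschitz _ _ _ _ 0) => s t _ _; rewrite subrr rnorm0 mul0r.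
  apply: ucontZ; [| |apply: ucontD => //; exact: ucontN|exact: bounded_onB].
    apply: (@ucont_lipschitz _ _ _ _ (phase_rate omega r `|T|)) => s t /KT sT /KT tT.
    have -> : (2 * g s)^-1 - (2 * g t)^-1 = 2^-1 * (g s)^-1 * (g t)^-1 * (g t - g s).
      have := g_neq0 omega r s; have := g_neq0 omega r t; move: (g s) (g t) => x y *.
      by field; rewrite ?pnatr_eq0; apply/andP.
    rewrite !rnormM n2 !rnormV ?rnorm_g ?invr1 ?mulr1 rdistC ler_pdivrMl// mulrA.
    exact: g_lipschitz.
  by exists 2^-1 => t _; rewrite invfM rnormM n2 rnormV rnorm_g invr1 mulr1.
exists u, v; split; last by move=> t _; exact: fuv.
  split; [apply/UC_ucont|exact/bounded_onP].
  apply: ucont_far_near => [T|e /far[T [d d0 h]]]; first by case: (near T).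
  by exists T, d => // s t *; case: (h s t).
split; [apply/UC_ucont|exact/bounded_onP].
apply: ucont_far_near => [T|e /far[T [d d0 h]]]; first by case: (near T).
by exists T, d => // s t *; case: (h s t).
Qed.
End Structure.

(** * Integrals of finitely valued functions *)

Section FiniteValued.
Context d (T : measurableType d).

(** Simple functions with values in a type that need not be X, so that pairs and
    triples of them can be formed. *)
Definition finval (Y : Type) (p : T -> Y) :=
  finite_set (range p) /\ forall y, measurable (p @^-1` [set y]).

Lemma finval_preimage (Y : choiceType) (p : T -> Y) (Q : set Y) :
  finval p -> measurable (p @^-1` Q).
Proof.
move=> [pfin pm].
have -> : p @^-1` Q = \bigcup_(y in range p `&` Q) (p @^-1` [set y]).
  by apply/seteqP; split=> [t Qt|t [y [_ Qy] /= ->//]]; exists (p t).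
by apply: fin_bigcup_measurable => //; exact: finite_setIl.
Qed.

Lemma finval_comp (Y Z : choiceType) (p : T -> Y) (q : Y -> Z) :
  finval p -> finval (q \o p).
Proof.
move=> pv; split=> [|z]; last exact: (finval_preimage (q @^-1` [set z])).
have -> : range (q \o p) = q @` range p by rewrite image_comp.
by apply: finite_image; case: pv.
Qed.

Lemma finval_pair (Y Z : choiceType) (p : T -> Y) (q : T -> Z) :
  finval p -> finval q -> finval (fun t => (p t, q t)).
Proof.
move=> [pfin pm] [qfin qm]; split=> [|[y z]].
  by apply: sub_finite_set (finite_setX pfin qfin) => _ [t _ <-]; split; exists t.
rewrite (_ : _ @^-1` _ = p @^-1` [set y] `&` q @^-1` [set z]); first exact: measurableI.
by apply/seteqP; split=> t /= [-> ->].
Qed.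

Lemma finval_measurable_fun (Y : choiceType) (p : T -> Y) d' (U : measurableType d')
  (h : Y -> U) (D : set T) : finval p -> measurable_fun D (h \o p).
Proof.
move=> pv mD B mB; apply: measurableI => //.
exact: (finval_preimage (h @^-1` B)).
Qed.

End FiniteValued.

Section SimpleIntegral.
Context d (T : measurableType d) (R : realType) (mu : {measure set T -> \bar R})
  (X : completeNormedModType R[i]).
Variable (D : set T).
Hypotheses (mD : measurable D) (Dfin : (mu D < +oo)%E).

Let mass (Y : choiceType) (p : T -> Y) z := mu (D `&` p @^-1` [set z]).

Let mass_fin (Y : choiceType) (p : T -> Y) z : finval p -> mass p z \is a fin_num.
Proof.
move=> [_ pm]; rewrite ge0_fin_numE//; apply: le_lt_trans Dfin.
by apply: le_measure; rewrite ?inE//; exact: measurableI.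
Qed.

(** Grouping the fibres of p according to the value of q recovers the fibres of
    the composite. *)
Lemma simple_integral_comp (Y : choiceType) (p : T -> Y) (q : Y -> X) :
  finval p -> simple_integral mu D (q \o p) =
    \sum_(z <- fset_set (range p)) (fine (mass p z))%:C *: q z.
Proof.
move=> pv; have [pfin pm] := pv; have [qfin qm] := finval_comp q pv.
rewrite /simple_integral fsbig_finite//=.
have E x : fine (mu (D `&` (q \o p) @^-1` [set x])) =
    \sum_(z <- fset_set (range p) | q z == x) fine (mass p z).
  rewrite (_ : D `&` _ = \bigcup_(z in range p `&` q @^-1` [set x]) (D `&` p @^-1` [set z])); last first.
    rewrite -setI_bigcupr; congr (_ `&` _); apply/seteqP; split=> [t /= qt|t [z [_ /= <-] <-//]].
    by exists (p t) => //; split=> //; exists t.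
  have fin : finite_set (range p `&` q @^-1` [set x]) by exact: finite_setIl.
  rewrite measure_fin_bigcup//; last 2 first.
  - by move=> y z _ _ [t [[_ <-] [_ <-]]].
  - by move=> z _; exact: measurableI.
  rewrite sum_fine; last by move=> z _; exact: mass_fin.
  rewrite fsbig_mkcondr fsbig_finite// [in RHS]big_mkcond /=.
  congr fine; apply: eq_bigr => z _.
  by congr (if _ then _ else _); apply/idP/eqP; rewrite inE.
under eq_bigr do rewrite E rmorph_sum /= scaler_suml.
rewrite (exchange_big_dep predT)//= big_seq [in RHS]big_seq; apply: eq_bigr => z.
rewrite in_fset_set// inE => -[t _ <-].
under eq_bigl do rewrite eq_sym.
rewrite -big_filter filter_pred1_uniq ?finmap.fset_uniq ?big_seq1//.
by rewrite in_fset_set// inE; exists t.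
Qed.

Lemma integral_finval (Y : choiceType) (p : T -> Y) (phi : Y -> R) :
  finval p -> (forall y, 0 <= phi y) ->
  (\int[mu]_(t in D) (phi (p t))%:E =
   (\sum_(z <- fset_set (range p)) phi z * fine (mass p z))%:E)%E.
Proof.
move=> pv phi0; have [pfin pm] := pv.
have -> : (\int[mu]_(t in D) (phi (p t))%:E = \int[mu]_(t in D)
    \sum_(z <- fset_set (range p)) ((phi z)%:E * (\1_(p @^-1` [set z]) t)%:E))%E.
  apply: eq_integral => t _.
  rewrite (bigD1_seq (p t))/= ?finmap.fset_uniq//; last first.
    by rewrite in_fset_set// inE; exists t.
  rewrite big1 => [|z zt]; rewrite indicE.
    by rewrite mem_set//= mule1 adde0.
  by rewrite memNset ?mule0//= => pz; move: zt; rewrite pz eqxx.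
rewrite ge0_integral_sum//.
- rewrite -sumEFin; apply: eq_bigr => z _.
  rewrite ge0_integralZl_EFin//.
  + by rewrite integral_indic// setIC EFinM fineK// mass_fin.
  + by apply/measurable_EFinP; exact: measurable_indic.
- move=> z; apply/measurable_EFinP; by apply: measurable_funM.
- by move=> z t _; rewrite mule_ge0// lee_fin.
Qed.

(** On a common refinement, both sides are sums over the values of (s1, s2). *)
Lemma simple_integral_dist (s1 s2 : T -> X) : finval s1 -> finval s2 ->
  ((rnorm (simple_integral mu D s1 - simple_integral mu D s2))%:E <=
    \int[mu]_(t in D) (rnorm (s1 t - s2 t))%:E)%E.
Proof.
move=> s1v s2v; pose p t := (s1 t, s2 t); have pv : finval p by exact: finval_pair.
have -> : simple_integral mu D s1 = simple_integral mu D (fst \o p) by [].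
have -> : simple_integral mu D s2 = simple_integral mu D (snd \o p) by [].
rewrite !simple_integral_comp// (integral_finval (p := p) (phi := fun z => rnorm (z.1 - z.2)))//; last first.
  by move=> z; exact: rnorm_ge0.
rewrite lee_fin -sumrB (le_trans (rnorm_sum _ _ _))//; apply: ler_sum => z _.
rewrite -scalerBr rnormZ rnorm_real ger0_norm 1?mulrC//.
by rewrite fine_ge0.
Qed.

Lemma simple_integral_cst (t0 : T) (c : X) :
  finval (cst c : T -> X) /\
  simple_integral mu D (cst c) = (fine (mu D))%:C *: c.
Proof.
have rangeE : range (cst c : T -> X) = [set c].
  by apply/seteqP; split=> [_ [t _ <-]//|_ ->]; exists t0.
split.
  split=> [|y]; first by rewrite rangeE.
  have [->|yc] := eqVneq y c.
    by rewrite (_ : _ @^-1` _ = setT)//; apply/seteqP.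
  rewrite (_ : _ @^-1` _ = set0)//; apply/seteqP; split=> // t /= cy.
  by move: yc; rewrite cy eqxx.
rewrite /simple_integral rangeE fsbig_set1 (_ : D `&` _ = D)//.
by apply/setIidPl => t _.
Qed.

End SimpleIntegral.

(** * The Bochner integral *)

Section BochnerIntegral.
Context d (T : measurableType d) (R : realType) (mu : {measure set T -> \bar R})
  (X : completeNormedModType R[i]).
Hypothesis (mu_complete : measure_is_complete mu).
Variable (D : set T).
Hypotheses (mD : measurable D) (Dfin : (mu D < +oo)%E).
Implicit Types (f s : T -> X) (u w : nat -> T -> X).

(** The integrand is almost everywhere the limit of measurable functions, and the
    measure is complete. *)
Lemma measurable_bochner_dist f u s : simple_ae_cvg mu D f u -> finval s ->
  measurable_fun D (fun t => (rnorm (f t - s t))%:E).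
Proof.
move=> [us uf] sv.
pose h m t := (rnorm (u m t - s t))%:E.
have mh m : measurable_fun D (h m).
  apply: (@finval_measurable_fun _ _ _ (fun t => (u m t, s t)) _ _
    (fun z => (rnorm (z.1 - z.2))%:E)); exact: (finval_pair (us m) sv).
apply: (ae_measurable_fun mu_complete) (measurable_fun_limn_esup mh).
apply: filterS uf => t uf Dt; have {}uf := uf Dt.
have hcvg : h n t @[n --> \oo] --> (rnorm (f t - s t))%:E.
  apply: cvg_EFin; first by near=> n.
  apply/cvgrPdist_lt => e e0; have := (cvg_rnorm (u ^~ t) (f t)).1 uf e e0.
  apply: filterS => n; apply: le_lt_trans.
  rewrite /h /= ler_norml; apply/andP; split.
    rewrite lerBrDl lerBlDr (le_trans (rdistD (f t) _ _))// rdistC.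
    by rewrite addrC.
  by rewrite lerBlDr (le_trans (rdistD (u n t) _ _)).
by rewrite is_cvg_limn_esupE; [exact/cvg_lim|apply/cvg_ex; eexists; exact: hcvg].
Unshelve. all: by end_near. Qed.

Lemma integral_dist_le f u s1 s2 : simple_ae_cvg mu D f u -> finval s1 -> finval s2 ->
  (\int[mu]_(t in D) (rnorm (s1 t - s2 t))%:E <=
    \int[mu]_(t in D) (rnorm (f t - s1 t))%:E +
    \int[mu]_(t in D) (rnorm (f t - s2 t))%:E)%E.
Proof.
move=> uf s1v s2v.
rewrite -ge0_integralD//; [|by move=> t _; rewrite lee_fin rnorm_ge0|
  exact: measurable_bochner_dist uf _|by move=> t _; rewrite lee_fin rnorm_ge0|
  exact: measurable_bochner_dist uf _].
apply: ge0_le_integral => //.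
- by move=> t _; rewrite lee_fin rnorm_ge0.
- apply: (@finval_measurable_fun _ _ _ (fun t => (s1 t, s2 t)) _ _
    (fun z => (rnorm (z.1 - z.2))%:E)); exact: finval_pair.
- by apply: emeasurable_funD; exact: measurable_bochner_dist uf _.
- by move=> t _; rewrite lee_fin (le_trans (rdistD (f t) _ _))// rdistC.
Qed.

Lemma bochner_approx_small f u : bochner_approx mu D f u -> forall e : R, 0 < e ->
  exists N, forall n, (N <= n)%N -> (\int[mu]_(t in D) (rnorm (f t - u n t))%:E < e%:E)%E.
Proof.
move=> [_ _ /fine_cvgP[fin /cvgrPdist_lt cv0]] e e0.
have [N _ hN] := filterI fin (cv0 _ e0); exists N => n /hN[/= finn].
rewrite add0r normrN -lte_fin => /lt_le_trans h; rewrite -(fineK finn) lte_fin.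
by rewrite -lte_fin; apply: (le_lt_trans _ (h _ (lexx _))); rewrite lee_fin ler_norm.
Qed.

(** Two approximating sequences are admitted: one gives both the existence of the
    limit and its independence of the sequence. *)
Lemma simple_integral_cauchy f u w : bochner_approx mu D f u -> bochner_approx mu D f w ->
  forall e : R, 0 < e -> exists N, forall n m, (N <= n)%N -> (N <= m)%N ->
  rnorm (simple_integral mu D (u n) - simple_integral mu D (w m)) < e.
Proof.
move=> ua wa e e0; have e20 : 0 < e / 2 by rewrite divr_gt0.
have [N uN] := bochner_approx_small ua e20.
have [N' wN] := bochner_approx_small wa e20.
exists (maxn N N') => n m; rewrite !geq_max => /andP[Nn _] /andP[_ Nm].
have [[us uf] _ _] := ua; have [[ws _] _ _] := wa.
rewrite -lte_fin (le_lt_trans (simple_integral_dist mD Dfin (us n) (ws m)))//.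
rewrite (le_lt_trans (integral_dist_le (conj us uf) (us n) (ws m)))//.
by rewrite (splitr e) EFinD lteD ?uN ?wN.
Qed.

Lemma simple_integral_is_cvg f u : bochner_approx mu D f u ->
  cvg (simple_integral mu D (u n) @[n --> \oo]).
Proof.
move=> ua; apply/cauchy_cvgP/cauchy_exP => e /posc_Re[e0 ->].
have [N IN] := simple_integral_cauchy ua ua e0.
exists (simple_integral mu D (u N)); exists N => // n /= Nn.
by rewrite -ball_normE /= normE ltc IN.
Qed.

Lemma is_bochner_integral_unique f v v' :
  is_bochner_integral mu D f v -> is_bochner_integral mu D f v' -> v = v'.
Proof.
move=> [u ua /cvg_rnorm uv] [w wa /cvg_rnorm wv].
apply/subr0_eq/rnorm_eq0/eqP; rewrite eq_le rnorm_ge0 andbT.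
apply/ler_addgt0Pr => e e0; rewrite add0r; have e30 : 0 < e / 3 by rewrite divr_gt0.
have [N IN] := simple_integral_cauchy ua wa e30.
near \oo => n.
rewrite (le_trans (rdistD (simple_integral mu D (u n)) _ _))//.
rewrite (le_trans (lerD (lexx _) (rdistD (simple_integral mu D (w n)) _ _)))//.
have h1 : rnorm (v - simple_integral mu D (u n)) < e / 3 by near: n; exact: uv.
have h2 : rnorm (v' - simple_integral mu D (w n)) < e / 3 by near: n; exact: wv.
have h3 := IN n n; rewrite rdistC in h2.
have Nn : (N <= n)%N by near: n; exists N.
have {}h3 := h3 Nn Nn; move: h1 h2 h3.
by move: (rnorm _) (rnorm _) (rnorm _) => *; lra.
Unshelve. all: by end_near. Qed.

Lemma bochner_integralE f v : is_bochner_integral mu D f v -> bochner_integral mu D f = v.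
Proof.
move=> fv; apply: (is_bochner_integral_unique _ fv).
by apply: (@getPex _ (is_bochner_integral mu D f)); exists v.
Qed.

Lemma bochner_approx_cvg f u : bochner_approx mu D f u ->
  simple_integral mu D (u n) @[n --> \oo] --> bochner_integral mu D f.
Proof.
move=> ua; have /cvg_ex[v uv] := simple_integral_is_cvg ua.
by rewrite (@bochner_integralE f v)//; exists u.
Qed.

(** With c a value of f, this plays the role of the fundamental theorem of
    calculus. *)
Lemma bochner_integral_near_cst (t0 : T) f (c : X) (M : R) :
  bochner_integrable mu D f -> (forall t, D t -> rnorm (f t - c) <= M) ->
  rnorm (bochner_integral mu D f - (fine (mu D))%:C *: c) <= M * fine (mu D).
Proof.
move=> [u ua] fM; have /cvg_rnorm uv := bochner_approx_cvg ua.
have [cv cE] := simple_integral_cst mu D t0 c.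
rewrite -cE; apply/ler_addgt0Pr => e e0; have e20 : 0 < e / 2 by rewrite divr_gt0.
have [N uN] := bochner_approx_small ua e20; have [[us uf] _ _] := ua.
near \oo => n.
rewrite (le_trans (rdistD (simple_integral mu D (u n)) _ _))//.
have h1 : rnorm (bochner_integral mu D f - simple_integral mu D (u n)) < e / 2.
  by near: n; exact: uv.
suff : rnorm (simple_integral mu D (u n) - simple_integral mu D (cst c)) <= e / 2 + M * fine (mu D).
  by move: h1; move: (rnorm _) (rnorm _) => *; lra.
have Nn : (N <= n)%N by near: n; exists N.
rewrite -lee_fin (le_trans (simple_integral_dist mD Dfin (us n) cv))//.
rewrite (le_trans (integral_dist_le (conj us uf) (us n) cv))// EFinD leeD//.
  by rewrite ltW// uN.
rewrite EFinM fineK ?ge0_fin_numE//.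
apply: (@le_trans _ _ (\int[mu]_(t in D) (cst M%:E t))%E).
  apply: ge0_le_integral => //.
  - by move=> t _; rewrite lee_fin rnorm_ge0.
  - exact: measurable_bochner_dist (conj us uf) cv.
by rewrite integral_cst.
Unshelve. all: by end_near. Qed.

End BochnerIntegral.

Section BochnerAdditivity.
Context d (T : measurableType d) (R : realType) (mu : {measure set T -> \bar R})
  (X : completeNormedModType R[i]).
Hypothesis (mu_complete : measure_is_complete mu).

Lemma bochner_approx_sub (D E : set T) (f : T -> X) u : measurable D -> measurable E ->
  (mu D < +oo)%E -> E `<=` D -> bochner_approx mu D f u -> bochner_approx mu E f u.
Proof.
move=> mD mE Dfin ED [[us uf] ui cv0]; split.
- split=> //; apply: filterS uf => t uf Et; exact/uf/ED.
- move=> n x x0; apply: le_lt_trans (ui n x x0); apply: le_measure; rewrite ?inE.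
  + by apply: measurableI => //; case: (us n).
  + by apply: measurableI => //; case: (us n).
  + exact: setSI.
apply: (@squeeze_cvge _ _ _ _ (cst 0%E) _
  (fun n => \int[mu]_(t in D) (complex.Re `|f t - u n t|)%:E)%E) => //; last exact: cvg_cst.
apply: nearW => n; apply/andP; split.
  by apply: integral_ge0 => t _; rewrite lee_fin rnorm_ge0.
apply: ge0_subset_integral => //.
  exact: (measurable_bochner_dist mu_complete (conj us uf) (us n)).
by move=> t _; rewrite lee_fin rnorm_ge0.
Qed.

Lemma simple_integral_setU (D E : set T) (s : T -> X) : measurable D -> measurable E ->
  (mu D < +oo)%E -> (mu E < +oo)%E -> mu (D `&` E) = 0%E -> finval s ->
  simple_integral mu (D `|` E) s = simple_integral mu D s + simple_integral mu E s.
Proof.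
move=> mD mE Dfin Efin DE0 [sfin sm].
rewrite /simple_integral !fsbig_finite// -big_split; apply: eq_bigr => x _ /=.
rewrite -scalerDl -rmorphD; congr ((_)%:C *: _); set A := s @^-1` _.
have mA : measurable A by exact: sm.
have fin B : measurable B -> (mu B < +oo)%E -> mu (B `&` A) \is a fin_num.
  move=> mB Bfin; rewrite ge0_fin_numE// (le_lt_trans _ Bfin)// le_measure ?inE//.
  exact: measurableI.
rewrite -fineD ?fin//; congr fine.
have EA0 : mu (D `&` E `&` A) = 0%E.
  apply/eqP; rewrite eq_le measure_ge0 andbT -[leRHS]DE0 le_measure ?inE//.
    by apply: measurableI => //; exact: measurableI.
  exact: measurableI.
rewrite setIUl measureUfinl ?fin//; [|exact: measurableI|exact: measurableI|by rewrite -ge0_fin_numE// fin].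
rewrite (_ : D `&` A `&` (E `&` A) = D `&` E `&` A) ?EA0 ?sube0//.
by rewrite setIACA setIid.
Qed.

(** A sequence that approximates f on the union approximates f on each part. *)
Lemma bochner_integral_setU (D E : set T) (f : T -> X) : measurable D -> measurable E ->
  (mu D < +oo)%E -> (mu E < +oo)%E -> mu (D `&` E) = 0%E ->
  bochner_integrable mu (D `|` E) f ->
  bochner_integral mu (D `|` E) f = bochner_integral mu D f + bochner_integral mu E f.
Proof.
move=> mD mE Dfin Efin DE0 [u ua].
have mDE : measurable (D `|` E) by exact: measurableU.
have DEfin : (mu (D `|` E) < +oo)%E.
  by apply: (le_lt_trans (measureU2 _ mD mE)); exact: lte_add_pinfty.
have uD := bochner_approx_sub mDE mD DEfin (@subsetUl _ D E) ua.
have uE := bochner_approx_sub mDE mE DEfin (@subsetUr _ D E) ua.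
apply: (bochner_integralE mu_complete mDE DEfin); exists u => //.
have -> : (fun n => simple_integral mu (D `|` E) (u n)) =
    (fun n => simple_integral mu D (u n) + simple_integral mu E (u n)).
  apply/funext => n; rewrite simple_integral_setU//.
  by case: uD => -[us _] _ _; exact: us.
by apply: cvgD; exact: bochner_approx_cvg.
Qed.

End BochnerAdditivity.

(** * Integrals over segments and primitives *)

Lemma ereal_cvg0 {R : realType} (I : nat -> \bar R) : (forall n, (0 <= I n)%E) ->
  (forall e : R, 0 < e -> exists N, forall n, (N <= n)%N -> (I n <= e%:E)%E) ->
  I n @[n --> \oo] --> 0%E.
Proof.
move=> I0 Ismall; have fin n e : (I n <= e%:E)%E -> I n \is a fin_num.
  by move=> Ie; rewrite ge0_fin_numE// (le_lt_trans Ie)// ltry.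
apply/fine_cvgP; split.
  by have [N hN] := Ismall 1 ltr01; exists N => // n /= /hN /fin.
apply/cvgrPdist_le => e e0; have [N hN] := Ismall e e0; exists N => // n /= /hN Ie.
by rewrite add0r normrN ger0_norm ?fine_ge0// -lee_fin fineK// (fin _ _ Ie).
Qed.

Section LebesgueSegment.
Context {R : realType} {X : completeNormedModType R[i]}.
Notation cmu := (@completed_lebesgue_measure R).
Notation T := (caratheodory_type (@wlength R idfun)^*%mu).
Implicit Types (f : R -> X) (a b c : R).

Lemma borel_measurable_cara (A : set R) : measurable A -> measurable (A : set T).
Proof. exact: sub_caratheodory. Qed.

Lemma segment_measurable a b : measurable (`[a, b]%classic : set T).
Proof. by apply: borel_measurable_cara; exact: measurable_itv. Qed.

Lemma completed_lebesgue_segment a b : a <= b -> cmu `[a, b]%classic = (b - a)%:E.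
Proof.
move=> ab; have := lebesgue_measure_itv `[a, b]; rewrite /= => E.
rewrite [LHS]E lte_fin -EFinD; move: ab; rewrite le_eqVlt => /predU1P[->|->//].
by rewrite ltxx subrr.
Qed.

Lemma completed_lebesgue_segment_fin a b : (cmu `[a, b]%classic < +oo)%E.
Proof.
have [ab|ab] := leP a b; first by rewrite completed_lebesgue_segment// ltry.
by rewrite set_itv_ge ?measure0// bnd_simp -ltNge.
Qed.

(** The minimum keeps the index finite outside of [a, b] and at b itself. *)
Definition grid_index a b n (t : R) : nat :=
  minn (Num.truncn ((t - a) / (b - a) * n.+1%:R)) n.+1.

Definition step_approx f a b n (t : T) : X :=
  f (a + (b - a) * ((grid_index a b n t)%:R / n.+1%:R)).

Lemma finval_grid_index a b n : finval (grid_index a b n : T -> nat).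
Proof.
split.
  apply: (@sub_finite_set _ _ `I_n.+2); last exact: finite_II.
  by move=> _ [t _ <-]; rewrite /= ltnS geq_minr.
move=> k; have mtrunc (j : nat) : measurable ([set t | (j <= Num.truncn ((t - a) / (b - a) * n.+1%:R))%N] : set T).
  case: j => [|j].
    rewrite (_ : [set _ | _] = setT); first exact: measurableT.
    by apply/seteqP; split.
  rewrite (_ : [set _ | _] = (fun t : R => (t - a) / (b - a) * n.+1%:R) @^-1` `[j.+1%:R, +oo[%classic).
    apply: borel_measurable_cara; rewrite -[X in measurable X]setTI.
    have mh : measurable_fun setT (fun t : R => (t - a) / (b - a) * n.+1%:R).
      by apply: measurable_funM => //; apply: measurable_funM => //; exact: measurable_funB.
    by apply: mh => //; exact: measurable_itv.
  by apply/seteqP; split=> t /=; rewrite in_itv /= andbT truncn_gt_nat.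
have mgrid j : measurable ([set t | (j <= grid_index a b n t)%N] : set T).
  have [jn|nj] := leqP j n.+1.
    rewrite (_ : [set _ | _] = [set t | (j <= Num.truncn ((t - a) / (b - a) * n.+1%:R))%N])//.
    by apply/seteqP; split=> t /=; rewrite /grid_index leq_min jn andbT.
  rewrite (_ : [set _ | _] = set0)//; apply/seteqP; split=> // t /=.
  by rewrite /grid_index leq_min => /andP[_]; rewrite leqNgt nj.
rewrite (_ : _ @^-1` _ = [set t | (k <= grid_index a b n t)%N] `\`
   [set t | (k.+1 <= grid_index a b n t)%N]); first exact: measurableD.
apply/seteqP; split=> t /=; first by move=> ->; rewrite leqnn ltnn.
by move=> [kl /negP]; rewrite -leqNgt => lk; apply/eqP; rewrite eqn_leq lk.
Qed.

Lemma step_approx_cvg f a b : ucont `[a, b]%classic f -> forall e : R, 0 < e ->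
  exists N, forall n, (N <= n)%N -> forall t, a <= t <= b ->
  rnorm (f t - step_approx f a b n t) < e.
Proof.
move=> fu e e0; have [d d0 fd] := fu _ e0.
exists (Num.truncn ((b - a) / d)) => n Nn t /andP[at_ tb].
have hd : (b - a) / n.+1%:R < d.
  rewrite ltr_pdivrMr ?ltr0Sn// mulrC -ltr_pdivrMr//.
  by rewrite (lt_le_trans (truncnS_gt _))// ler_nat ltnS.
rewrite /step_approx /grid_index.
have [ab|ab] := eqVneq a b.
  have -> : t = a by apply/eqP; rewrite eq_le at_ {1}ab tb.
  by rewrite ab subrr mul0r addr0 subrr rnorm0.
have ba0 : 0 < b - a by rewrite subr_gt0 lt_neqAle ab (le_trans at_).
set x := (t - a) / (b - a) * n.+1%:R.
have x0 : 0 <= x by rewrite mulr_ge0// divr_ge0 ?(ltW ba0)// subr_ge0.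
have xn : x <= n.+1%:R.
  by rewrite ler_piMl// ler_pdivrMr// mul1r lerD2r.
have /andP[k1 k2] := truncn_itv x0.
have -> : minn (Num.truncn x) n.+1 = Num.truncn x.
  by apply/minn_idPl; rewrite -(ler_nat R) (le_trans k1).
set k := Num.truncn x in k1 k2 *.
have n0 : 0 < n.+1%:R :> R by rewrite ltr0Sn.
have tE : t = a + (b - a) * (x / n.+1%:R).
  by rewrite /x mulfK ?gt_eqF// mulrCA divff ?gt_eqF// mulr1 addrC subrK.
have kx : (b - a) * (k%:R / n.+1%:R) <= (b - a) * (x / n.+1%:R).
  by rewrite ler_pM2l// ler_pM2r ?invr_gt0.
apply: fd; rewrite /= ?in_itv /= ?at_ ?tb//.
  rewrite lerDl mulr_ge0 ?divr_ge0 ?(ltW ba0)//=.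
  by apply: le_trans tb; rewrite [leRHS]tE lerD2l.
rewrite {1}tE opprD addrACA subrr add0r ger0_norm ?subr_ge0//.
apply: le_lt_trans hd; rewrite -mulrBr -mulrBl mulrA ler_pM2r ?invr_gt0//.
rewrite ler_piMr ?(ltW ba0)// lerBlDl natr1 ltW//.
Qed.

Lemma ucont_bochner_integrable f a b : ucont `[a, b]%classic f ->
  bochner_integrable cmu `[a, b]%classic f.
Proof.
move=> fu; exists (step_approx f a b).
have sv n : finval (step_approx f a b n).
  exact: (finval_comp (fun k => f (a + (b - a) * (k%:R / n.+1%:R))) (finval_grid_index a b n)).
have mD := segment_measurable a b; have Dfin := completed_lebesgue_segment_fin a b.
have fcvg := step_approx_cvg fu.
have sae : simple_ae_cvg cmu `[a, b]%classic f (step_approx f a b).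
  split=> //; apply: aeW => t /=; rewrite in_itv /= => abt.
  apply/cvg_rnorm => e /fcvg[N hN]; exists N => // n Nn; exact: hN.
split=> //.
  move=> n x _; apply: le_lt_trans Dfin; apply: le_measure; rewrite ?inE//.
  by apply: measurableI => //; case: (sv n).
apply: ereal_cvg0 => [n|e e0].
  by apply: integral_ge0 => t _; rewrite lee_fin rnorm_ge0.
have M1 : 0 < fine (cmu `[a, b]%classic) + 1 by rewrite ltr_wpDl// fine_ge0.
have [N hN] := fcvg (e / (fine (cmu `[a, b]%classic) + 1)) (divr_gt0 e0 M1).
exists N => n Nn.
apply: (@le_trans _ _ (e / (fine (cmu `[a, b]%classic) + 1) * fine (cmu `[a, b]%classic))%:E).
  rewrite EFinM fineK ?ge0_fin_numE// -(integral_cst cmu mD).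
  apply: (ge0_le_integral cmu mD).
  - by move=> t _; rewrite lee_fin rnorm_ge0.
  - exact: (measurable_bochner_dist completed_lebesgue_measure_is_complete sae (sv n)).
  - exact: measurable_cst.
  - by move=> t; rewrite /= in_itv /= => abt; rewrite lee_fin ltW// hN.
by rewrite lee_fin mulrAC ler_pdivrMr// ler_pM2l// lerDl.
Qed.

Lemma bochner_integral_segment_near_cst f (c : X) (M : R) a b : a <= b ->
  ucont `[a, b]%classic f -> (forall t, a <= t <= b -> rnorm (f t - c) <= M) ->
  rnorm (bochner_integral cmu `[a, b]%classic f - (b - a)%:C *: c) <= M * (b - a).
Proof.
move=> ab /ucont_bochner_integrable fi fM.
have <- : fine (cmu `[a, b]%classic) = b - a by rewrite completed_lebesgue_segment.
apply: (bochner_integral_near_cst completed_lebesgue_measure_is_complete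
  (segment_measurable a b) (completed_lebesgue_segment_fin a b) (0 : R)) => //.
Qed.

Lemma bochner_integral_segment_cat f a b c : a <= b -> b <= c ->
  ucont `[a, c]%classic f ->
  bochner_integral cmu `[a, c]%classic f =
  bochner_integral cmu `[a, b]%classic f + bochner_integral cmu `[b, c]%classic f.
Proof.
move=> ab bc /ucont_bochner_integrable.
have -> : `[a, c]%classic = `[a, b]%classic `|` `[b, c]%classic :> set R.
  apply/seteqP; split=> t /=; rewrite !in_itv /=.
    by move=> /andP[at_ tc]; have [tb|/ltW bt] := leP t b; [left|right]; apply/andP.
  by case=> /andP[? ?]; apply/andP; split; [| exact: le_trans bc|exact: le_trans ab _|].
apply: bochner_integral_setU (segment_measurable _ _) (segment_measurable _ _)
  (completed_lebesgue_segment_fin _ _) (completed_lebesgue_segment_fin _ _) _.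
  exact: completed_lebesgue_measure_is_complete.
have -> : `[a, b]%classic `&` `[b, c]%classic = `[b, b]%classic :> set R.
  apply/seteqP; split=> t /=; rewrite !in_itv /=.
    by case=> /andP[_ ->] /andP[->].
  by move=> /andP[bt tb]; rewrite bt tb (le_trans ab bt) (le_trans tb bc).
by apply: (etrans (completed_lebesgue_segment (lexx b))); rewrite subrr.
Qed.

Lemma primitive_increment (J : set R) (alpha0 : R) f s t : is_interval J ->
  (forall a b, J a -> J b -> ucont `[a, b]%classic f) ->
  J alpha0 -> J s -> J t -> s <= t ->
  primitive alpha0 f t - primitive alpha0 f s = bochner_integral cmu `[s, t]%classic f.
Proof.
move=> Jitv fu J0 Js Jt st; rewrite /primitive.
have [as_|sa] := leP alpha0 s.
  have E := bochner_integral_segment_cat as_ st (fu _ _ J0 Jt).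
  by rewrite (le_trans as_ st) E [X in X - _]addrC addrK.
have [at_|ta] := leP alpha0 t.
  by rewrite opprK addrC -(bochner_integral_segment_cat (ltW sa) at_ (fu _ _ Js Jt)).
have E := bochner_integral_segment_cat st (ltW ta) (fu _ _ Js J0).
by rewrite opprK E addrC addrK.
Qed.

Lemma primitive_near_cst (J : set R) (alpha0 : R) f s t (c : X) (M : R) :
  is_interval J -> (forall a b, J a -> J b -> ucont `[a, b]%classic f) ->
  J alpha0 -> J s -> J t -> s <= t ->
  (forall x, s <= x <= t -> rnorm (f x - c) <= M) ->
  rnorm (primitive alpha0 f t - primitive alpha0 f s - (t - s)%:C *: c) <= M * (t - s).
Proof.
move=> Jitv fu J0 Js Jt st fM; rewrite (primitive_increment Jitv)//.
by apply: bochner_integral_segment_near_cst => //; exact: fu.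
Qed.

End LebesgueSegment.

(** * Expansion of the primitive of u + g v *)

Section SumMulRegularity.
Context {R : realType} {X : completeNormedModType R[i]}.
Variables (omega r : R) (r1 : 1 < r).
Local Notation g := (g omega r).
Variables (J : set R) (Jitv : is_interval J) (f u v : R -> X).
Hypotheses (uu : ucont J u) (vu : ucont J v).
Hypothesis (fE : forall t, J t -> f t = u t + g t *: v t).

Lemma sum_mul_ucont_near T : ucont (J `&` [set t | `|t| <= T]) f.
Proof.
set K := J `&` _.
apply: (@eq_ucont _ _ _ (fun t => u t + g t *: v t)) => [t [Jt _]|]; first by rewrite fE.
apply: ucontD; first by apply: sub_ucont uu => t [].
apply: ucontZ.
- apply: (@ucont_lipschitz _ _ _ _ (2 * phase_rate omega r T)) => s t [_ /= sT] [_ /= tT].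
  exact: g_lipschitz.
- by exists 1 => t _; rewrite rnorm_g.
- by apply: sub_ucont vu => t [].
- exact: ucont_bounded_on.
Qed.

Lemma sum_mul_bounded_near T : bounded_on (J `&` [set t | `|t| <= T]) f.
Proof.
have [A uA] := ucont_bounded_on T Jitv uu; have [B vB] := ucont_bounded_on T Jitv vu.
exists (A + B) => t Kt; rewrite fE; last by case: Kt.
rewrite (le_trans (rnormD _ _))// lerD ?uA//.
by rewrite rnormZ rnorm_g mul1r vB.
Qed.

Lemma sum_mul_ucont_segment a b : `[a, b]%classic `<=` J -> ucont `[a, b]%classic f.
Proof.
move=> abJ; apply: sub_ucont (sum_mul_ucont_near (`|a| + `|b|)) => t abt.
split; first exact: abJ.
move: abt; rewrite /= in_itv /= => /andP[at_ tb].
have := ler_norm b; have := ler_norm (- a); rewrite normrN => *.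
have := normr_ge0 a; have := normr_ge0 b => *.
rewrite ler_norml; apply/andP; split; lra.
Qed.

Lemma sum_mul_L1loc : L1loc J f.
Proof. by move=> a b /sum_mul_ucont_segment; exact: ucont_bochner_integrable. Qed.

Lemma interval_segment a b : J a -> J b -> `[a, b]%classic `<=` J.
Proof. by move=> Ja Jb t; rewrite /= in_itv /= => abt; exact: (Jitv Ja Jb). Qed.

End SumMulRegularity.

Section LinearBound.
Context {R : realType} {V : normedZmodType R[i]}.

Lemma ucont_linear_bound (J : set R) (f : R -> V) : is_interval J -> ucont J f ->
  exists2 D : R, 0 < D & forall t, J t -> rnorm (f t) <= D * (1 + `|t|).
Proof.
move=> Jitv fu; have [C C0 fC] := ucont_linear_growth Jitv fu.
have [[s Js]|J0] := pselect (exists s, J s); last first.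
  by exists 1 => // t Jt; case: J0; exists t.
exists (rnorm (f s) + C * (1 + `|s|)).
  by rewrite ltr_wpDl ?rnorm_ge0// mulr_gt0// ltr_wpDr.
move=> t Jt; rewrite -[f t](subrK (f s)) addrC (le_trans (rnormD _ _))//.
apply: (@le_trans _ _ (rnorm (f s) + C * (1 + (`|t| + `|s|)))).
  by rewrite lerD2l (le_trans (fC _ _ Jt Js))// ler_pM2l// lerD2l ler_normB.
have h1 : 0 <= rnorm (f s) * `|t| by rewrite mulr_ge0 ?rnorm_ge0.
have h2 : 0 <= C * (`|s| * `|t|) by rewrite mulr_ge0 ?(ltW C0)// mulr_ge0.
lra.
Qed.

End LinearBound.

Lemma near_same_sign {R : realDomainType} (x t : R) : 2 <= `|t| -> `|x - t| <= 1 ->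
  0 < x * t /\ 1 <= `|x| <= `|t| + 1.
Proof.
move=> t2; rewrite ler_norml => /andP[xt tx].
have [t0|t0] := leP 0 t; move: t2.
  rewrite (ger0_norm t0) => t2; have x0 : 0 < x by lra.
  by rewrite (gtr0_norm x0); split; [rewrite mulr_gt0//; lra|apply/andP; split; lra].
rewrite (ltr0_norm t0) => t2; have x0 : x < 0 by lra.
by rewrite (ltr0_norm x0); split; [rewrite nmulr_lgt0|apply/andP; split; lra].
Qed.

Lemma same_sign_trans {R : realDomainType} (x y t : R) : 0 < x * t -> 0 < y * t -> 0 < x * y.
Proof.
move=> xt yt; have t20 : 0 < t * t.
  by rewrite -expr2 exprn_even_gt0//=; apply: contraTneq xt => ->; rewrite mulr0 ltxx.
by rewrite -(pmulr_lgt0 _ t20) mulrACA mulr_gt0.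
Qed.

Lemma sub_subAC {V : zmodType} (p q a b : V) : p - q - (a - b) = (p - a) - (q - b).
Proof. by rewrite opprD opprK addrACA opprD opprK. Qed.

Section PrimitiveExpansion.
Context {R : realType} {X : completeNormedModType R[i]}.
Variables (omega r : R) (omega0 : omega != 0) (r1 : 1 < r) (r2 : r <= 2).
Local Notation g := (g omega r).
Variables (J : set R) (HJ : unbounded_right_interval J) (f u v : R -> X).
Variables (alpha0 : R) (J0 : J alpha0).
Hypotheses (uu : ucont J u) (vu : ucont J v).
Hypothesis (fE : forall t, J t -> f t = u t + g t *: v t).
Local Notation F := (primitive alpha0 f).
Let Jitv := unbounded_right_is_interval HJ.
Let fu a b (Ja : J a) (Jb : J b) : ucont `[a, b]%classic f :=
  sum_mul_ucont_segment r1 Jitv uu vu fE (interval_segment Jitv Ja Jb).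

Lemma primitive_lipschitz_near T : exists2 C, 0 <= C & forall s t, J s -> J t ->
  `|s| <= T -> `|t| <= T -> rnorm (F s - F t) <= C * `|s - t|.
Proof.
have [B fB] := sum_mul_bounded_near Jitv uu vu fE T.
exists `|B| => // s t; wlog st : s t / t <= s => [hw|] Js Jt sT tT.
  have [/hw|/ltW/hw] := leP t s; first exact.
  by move=> h; rewrite (rdistC (F s)) (distrC s); exact: h.
rewrite (ger0_norm (_ : 0 <= s - t)) ?subr_ge0//.
suff fB' x : t <= x <= s -> rnorm (f x - 0) <= `|B|.
  by have := primitive_near_cst Jitv fu J0 Jt Js st fB'; rewrite scaler0 subr0.
move=> /andP[tx xs]; rewrite subr0.
apply: le_trans (ler_norm B); apply: fB; split.
  by apply: (Jitv Jt Js); rewrite tx.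
by move: sT tT; rewrite /= !ler_norml => /andP[? ?] /andP[? ?]; apply/andP; split; lra.
Qed.

(** One integration by parts: g v has a primitive close to g v / (i p'), where p'
    is the derivative of the phase. *)
Definition osc_amplitude t : X := ('i%C * (dphase omega r t)%:C)^-1 *: v t.

Lemma dphase_neq0 t : t != 0 -> dphase omega r t != 0.
Proof.
move=> t0; rewrite /dphase mulf_neq0// mulf_neq0 ?sgr_eq0// mulf_neq0//.
  by rewrite gt_eqF// (lt_trans ltr01).
by rewrite gt_eqF// powR_gt0// normr_gt0.
Qed.

(** Subtracting x u t + g x W from F leaves a function whose formal derivative
    u x - u t + g x (v x - v t) + g x (1 - p' x / p' t) v t is bounded near t. *)
Lemma primitive_expansion : exists2 C, 0 <= C & forall s t, J s -> J t ->
  2 <= `|t| -> `|s - t| <= 1 ->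
  rnorm (F s - F t - (s - t)%:C *: u t - (g s - g t) *: osc_amplitude t)
    <= C * `|s - t|.
Proof.
have [A A0 uA] := ucont_linear_growth Jitv uu.
have [B B0 vB] := ucont_linear_growth Jitv vu.
have [D D0 vD] := ucont_linear_bound Jitv vu.
exists (2 * A + 2 * B + 2 * D); first by rewrite !addr_ge0 ?mulr_ge0// ltW.
move=> s t Js Jt t2 st; set W := osc_amplitude t.
pose E x := F x - x%:C *: u t - g x *: W.
suff main a b : J a -> J b -> a <= b -> (forall x, a <= x <= b -> `|x - t| <= 1) ->
    rnorm (E b - E a) <= (2 * A + 2 * B + 2 * D) * (b - a).
  have -> : F s - F t - (s - t)%:C *: u t - (g s - g t) *: W = E s - E t.
    by rewrite /E rmorphB /= !scalerBl [RHS]sub_subAC [X in _ = X - _]sub_subAC.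
  have [ts|/ltW ts] := leP t s.
    rewrite [in leRHS]ger0_norm ?subr_ge0// main// => x /andP[tx xs].
    rewrite ger0_norm ?subr_ge0//; move: st; rewrite ger0_norm ?subr_ge0//; lra.
  rewrite rdistC distrC ger0_norm ?subr_ge0// main// => x /andP[sx xt].
  rewrite distrC ger0_norm ?subr_ge0//; move: st; rewrite distrC ger0_norm ?subr_ge0//; lra.
move=> Ja Jb ab abt.
have t0 : 0 < `|t| by lra.
have tneq0 : t != 0 by rewrite -normr_gt0.
have same x : a <= x <= b -> 0 < x * t /\ 1 <= `|x| <= `|t| + 1.
  by move=> /abt; exact: near_same_sign.
apply: rnorm_mean_value => // e e0.
have e20 : 0 < e / 2 by rewrite divr_gt0.
have [d d0 fd] := fu Ja Jb e20.
set K := phase_rate omega r (`|t| + 1) + 2 * phase_rate omega r (`|t| + 1) ^+ 2.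
have K0 : 0 <= K.
  by apply: addr_ge0; [exact: phase_rate_ge0|rewrite mulr_ge0// sqr_ge0].
have KW1 : 0 < K * rnorm W + 1 by rewrite ltr_wpDl// mulr_ge0 ?rnorm_ge0.
exists (Num.min d (e / 2 / (K * rnorm W + 1))); first by rewrite lt_min d0 divr_gt0.
move=> x y ax xy yb; rewrite lt_min => /andP[xyd xye].
have xab : a <= x <= b by rewrite ax (le_trans xy).
have yab : a <= y <= b by rewrite yb (le_trans ax).
have [Jx Jy] : J x /\ J y by split; exact: (Jitv Ja Jb).
have [xt_ x1] := same _ xab; have [yt_ y1] := same _ yab.
have xy0 := same_sign_trans yt_ xt_.
set z := (`|x| / `|t|) `^ (r - 1).
set rho := g y - g x - 'i%C * (dphase omega r x * (y - x))%:C * g x.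
have rho_le : rnorm (rho *: W) <= e / 2 * (y - x).
  rewrite rnormZ (@le_trans _ _ (K * (y - x) ^+ 2 * rnorm W))//.
    by rewrite ler_wpM2r ?rnorm_ge0// g_taylor.
  rewrite expr2 mulrA mulrAC ler_wpM2r ?subr_ge0//.
  move: xye; rewrite ltr_pdivlMr// => xye; rewrite (le_trans _ (ltW xye))//.
  rewrite mulrAC [leRHS]mulrC ler_wpM2r ?subr_ge0//.
  by rewrite lerDl.
have F_le : rnorm (F y - F x - (y - x)%:C *: f x) <= e / 2 * (y - x).
  apply: (primitive_near_cst Jitv fu) => // q /andP[xq qy].
  apply/ltW/fd; rewrite /= ?in_itv /= ?xab//.
    by rewrite (le_trans ax xq) (le_trans qy yb).
  by rewrite ger0_norm ?subr_ge0//; lra.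
have core_le : rnorm (u x - u t + g x *: (v x - v t) + (g x * (1 - z)%:C) *: v t) <= 2 * A + 2 * B + 2 * D.
  have le2 (C q : R) : 0 < C -> q <= 1 -> C * (1 + q) <= 2 * C.
    by move=> C0 q1; rewrite mulrC ler_pM2r//; lra.
  have xt1 := abt _ xab.
  have h1 : rnorm (u x - u t) <= 2 * A by rewrite (le_trans (uA _ _ Jx Jt))// le2.
  have h2 : rnorm (g x *: (v x - v t)) <= 2 * B.
    by rewrite rnormZ rnorm_g mul1r (le_trans (vB _ _ Jx Jt))// le2.
  have h3 : rnorm ((g x * (1 - z)%:C) *: v t) <= 2 * D.
    rewrite rnormZ rnormM rnorm_g mul1r rnorm_real.
    apply: (@le_trans _ _ (`|1 - z| * (D * (2 * `|t|)))).
      by rewrite ler_wpM2l// (le_trans (vD _ Jt))// ler_pM2l//; lra.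
    rewrite (_ : _ * _ = `|1 - z| * `|t| * (2 * D)); last by ring.
    rewrite ler_piMl ?mulr_ge0 ?(ltW D0)//.
    exact: le_trans (dphase_ratio_le r1 r2 xt_) xt1.
  rewrite (le_trans (rnormD _ _))// lerD// (le_trans (rnormD _ _))// lerD//.
have EE : E y - E x = (F y - F x - (y - x)%:C *: f x) +
  ((y - x)%:C *: (u x - u t + g x *: (v x - v t) + (g x * (1 - z)%:C) *: v t) - rho *: W).
  have -> : u x - u t + g x *: (v x - v t) + (g x * (1 - z)%:C) *: v t =
      f x - (u t + (g x * z%:C) *: v t).
    rewrite (fE Jx) rmorphB /= mulrBr mulr1 scalerBr scalerBl opprD [RHS]addrA.
    by rewrite -(addrA (u x - u t)) (addrA (_ - g x *: v t)) subrK addrACA addrA.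
  have -> : rho *: W = (g y - g x) *: W - (y - x)%:C *: ((g x * z%:C) *: v t).
    rewrite /rho scalerBl; congr (_ - _).
    rewrite /W /osc_amplitude (dphase_ratio omega r xt_) -/z !scalerA; congr (_ *: _).
    have dt0 : (dphase omega r t)%:C != 0 :> R[i].
      by rewrite -(rmorph0 (real_complex R)) (inj_eq (@complexI R)) dphase_neq0.
    have i0 : 'i%C != 0 :> R[i].
      by rewrite eq_complex /= negb_and oner_eq0 orbT.
    move: (dphase omega r t) dt0 => p p0; rewrite !rmorphM /=.
    by field; rewrite i0 p0.
  rewrite /E sub_subAC [X in X - _]sub_subAC -!scalerBl -rmorphB scalerBr scalerDr.
  by rewrite opprD opprB !addrA !subrK.
rewrite EE (le_trans (rnormD _ _))//.
rewrite (le_trans (lerD F_le (rnormB _ _)))//.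
rewrite rnormZ rnorm_real (ger0_norm (_ : 0 <= y - x)) ?subr_ge0//.
have yx0 : 0 <= y - x by rewrite subr_ge0.
have := ler_wpM2l yx0 core_le; move: rho_le.
move: (rnorm (rho *: W)) (rnorm (u x - _ + _ + _)) (y - x) => p q k h1 h2.
lra.
Qed.
End PrimitiveExpansion.

(** * Bounded primitives *)

Section BoundedPrimitive.
Context {R : realType} {X : completeNormedModType R[i]}.
Variables (omega r : R) (omega0 : omega != 0) (r1 : 1 < r) (r2 : r <= 2).
Local Notation g := (g omega r).
Variables (J : set R) (HJ : unbounded_right_interval J) (f u v : R -> X).
Variables (alpha0 : R) (J0 : J alpha0).
Hypotheses (uu : ucont J u) (vu : ucont J v).
Hypothesis (fE : forall t, J t -> f t = u t + g t *: v t).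
Local Notation F := (primitive alpha0 f).
Hypothesis (Fb : bounded_on J F).
Let Jitv := unbounded_right_is_interval HJ.

(** At s = theta t the expansion bounds the amplitude W by a fraction of u t, and
    at s = t + 1 it bounds u t by W. *)
Lemma slow_part_bounded : bounded_on J u.
Proof.
have [M FM] := Fb.
have [C C0 FC] := primitive_expansion omega0 r1 r2 HJ J0 uu vu fE.
have [theta [thetaJ _ theta_far]] := antiphase_map_exists omega0 r1 HJ.
have [T hT] := theta_far 2^-1 (ltac:(by rewrite invr_gt0)).
have [B uB] := ucont_bounded_on (Num.max T 2) Jitv uu.
exists (Num.max B (8 * M + 4 * C)) => t Jt; rewrite le_max.
have [tT|] := leP `|t| (Num.max T 2); first by rewrite uB.
rewrite gt_max => /andP[/ltW Tt /ltW t2]; apply/orP; right.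
have [thetat gt] := hT _ Jt Tt.
have J1 : J (t + 1) by apply: (unbounded_right_up HJ Jt); rewrite lerDl.
set W := osc_amplitude omega r v t.
have FB s : J s -> rnorm (F s - F t) <= 2 * M.
  by move=> Js; rewrite (le_trans (rnormB _ _))// mulr_natl mulr2n lerD// FM.
have theta1 : `|theta t - t| <= 1 by rewrite (le_trans (ltW thetat))// invf_le1 ?ler1n.
have h1 : 2 * rnorm W <= 2 * M + C + 2^-1 * rnorm (u t).
  have := FC _ _ (thetaJ _ Jt) Jt t2 theta1.
  have -> : g (theta t) - g t = - (2 * g t) by rewrite gt mulr_natl mulr2n opprD.
  rewrite scaleNr opprK -/W => h.
  have -> : 2 * rnorm W = rnorm ((2 * g t) *: W).
    by rewrite (rnormZ (2 * g t)) rnormM rnorm_g mulr1 rnorm_nat.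
  have -> : (2 * g t) *: W =
    (F (theta t) - F t - (theta t - t)%:C *: u t + (2 * g t) *: W) -
    ((F (theta t) - F t) - (theta t - t)%:C *: u t).
    by rewrite addrC addrA addNr add0r.
  have h2 : rnorm ((theta t - t)%:C *: u t) <= 2^-1 * rnorm (u t).
    by rewrite rnormZ rnorm_real ler_wpM2r ?rnorm_ge0// ltW.
  rewrite (le_trans (rnormB _ _))// (le_trans (lerD h (rnormB _ _)))//.
  have h3 := FB _ (thetaJ _ Jt).
  have h4 : C * `|theta t - t| <= C by rewrite ler_piMr.
  by move: h2 h3 h4; move: (rnorm _) (rnorm _) (rnorm _) (C * _) => *; lra.
have h2 : rnorm (u t) <= 2 * M + C + 2 * rnorm W.
  have := FC (t + 1) t J1 Jt t2; rewrite (addrC t) addrK normr1 => /(_ (lexx _)).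
  rewrite mulr1 scale1r => h.
  have -> : u t = (F (1 + t) - F t) - (g (1 + t) - g t) *: W -
    (F (1 + t) - F t - u t - (g (1 + t) - g t) *: W).
    by rewrite opprD opprK addrACA addNr addr0 opprD opprK addrA subrr add0r.
  rewrite (le_trans (rnormB _ _))// (le_trans (lerD (rnormB _ _) h))//.
  rewrite rnormZ; have h3 := FB _ J1; rewrite (addrC t) in h3.
  have h4 : rnorm (g (1 + t) - g t) * rnorm W <= 2 * rnorm W.
    by rewrite ler_wpM2r ?rnorm_ge0// rnorm_gB.
  by move: h3 h4; move: (rnorm (F _ - _)) (_ * rnorm W) => *; lra.
by move: h1 h2; move: (rnorm W) (rnorm (u t)) => *; lra.
Qed.

Lemma primitive_locally_span1g : locally_span1g omega r J F.
Proof.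
have [B uB] := slow_part_bounded.
have [C C0 FC] := primitive_expansion omega0 r1 r2 HJ J0 uu vu fE.
have [L L0 FL] := primitive_lipschitz_near r1 HJ J0 uu vu fE 3.
move=> e e0; set K := C + `|B| + L + 1.
have K0 : 0 < K by rewrite ltr_wpDl// !addr_ge0.
exists (Num.min 1 (e / (4 * K))); first by rewrite lt_min ltr01 divr_gt0// mulr_gt0.
move=> s1 s2 s3 J1 J2 J3; rewrite !lt_min => /andP[s21 s2e] /andP[s31 s3e].
(* up to an increment of g, which the form does not see, F is Lipschitz *)
suff [W hW] : exists W : X, forall s, J s -> `|s - s1| < 1 ->
    rnorm (F s - F s1 - (g s - g s1) *: W) <= K * `|s - s1|.
  have split s : F s - F s1 = (F s - F s1 - (g s - g s1) *: W) + (g s - g s1) *: W.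
    by rewrite subrK.
  rewrite (altg_cancel (split s2) (split s3)).
  have small q : q < e / (4 * K) -> K * q < e / 4.
    by rewrite ltr_pdivlMr ?mulr_gt0// mulrCA (mulrC q) => qe; lra.
  apply: rnorm_altg_lt.
    exact: le_lt_trans (hW _ J2 s21) (small _ s2e).
  exact: le_lt_trans (hW _ J3 s31) (small _ s3e).
have [t2|t2] := leP 2 `|s1|.
  exists (osc_amplitude omega r v s1) => s Js ss1.
  have := FC s s1 Js J1 t2 (ltW ss1); set W := osc_amplitude _ _ _ _.
  move=> h; have -> : F s - F s1 - (g s - g s1) *: W =
    (F s - F s1 - (s - s1)%:C *: u s1 - (g s - g s1) *: W) + (s - s1)%:C *: u s1.
    by rewrite [RHS]addrAC subrK.
  rewrite (le_trans (rnormD _ _))// (le_trans (lerD h (lexx _)))//.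
  rewrite rnormZ rnorm_real (mulrC `|s - s1|) -mulrDl ler_wpM2r//.
  by have := uB _ J1; have := ler_norm B; rewrite /K; lra.
exists 0 => s Js ss1; rewrite scaler0 subr0 (le_trans (FL _ _ Js J1 _ _))//.
- rewrite -(subrK s1 s) (le_trans (ler_normD _ _))//; lra.
- lra.
- by rewrite ler_wpM2r// /K; have := normr_ge0 B; lra.
Qed.

Lemma bounded_primitive_sum_mul : sum_mul J g (BUC J) (BUC J) F.
Proof.
apply: bounded_decomposition => // [T|]; last exact: primitive_locally_span1g.
have [L L0 FL] := primitive_lipschitz_near r1 HJ J0 uu vu fE T.
by apply: (ucont_lipschitz (C := L)) => s t [Js sT] [Jt tT]; exact: FL.
Qed.

End BoundedPrimitive.

(** * Translation invariance of the completed Lebesgue measure *)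

Section Translation.
Context {R : realType}.
Notation cmu := (@completed_lebesgue_measure R).
Notation T := (caratheodory_type (@wlength R idfun)^*%mu).
Implicit Types (s : R) (A : set R).

Definition translate s A : set R := [set h | A (s + h)].

Lemma translateK s A : translate (- s) (translate s A) = A.
Proof. by apply/seteqP; split=> h; rewrite /translate /= addrA subrr add0r. Qed.

Lemma ocitv_translate s A : ocitv A ->
  ocitv (translate s A) /\ wlength idfun (translate s A) = wlength idfun A.
Proof.
move=> [[a b] _ /= <-].
have -> : translate s `]a, b]%classic = `]a - s, b - s]%classic.
  by apply/seteqP; split=> h; rewrite /translate /= !in_itv /= ltrBlDl lerBrDl.
split; first by exists (a - s, b - s).
have [ab|ba] := leP a b.
  by rewrite !wlength_itv_bnd ?lerD2r//= opprB addrA subrK.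
by rewrite !set_itv_ge ?bnd_simp -?leNgt ?lerD2r ?(ltW ba).
Qed.

Let outer_translate_le s A : ((wlength idfun)^*%mu (translate s A) <= (wlength idfun)^*%mu A :> \bar R)%E.
Proof.
apply/ereal_infP => _ [F [mF AF] <-].
pose G k := translate s (F k).
have FG k : wlength idfun (G k) = wlength idfun (F k) by case: (ocitv_translate s (mF k)).
rewrite -(eq_eseriesr (fun k _ => FG k)); apply: ereal_inf_lbound; exists G => //.
split=> [k|h Ah]; first by case: (ocitv_translate s (mF k)).
by have [k _ Fk] := AF _ Ah; exists k.
Qed.

Lemma completed_lebesgue_translate s A : cmu (translate s A) = cmu A.
Proof.
apply/eqP; rewrite eq_le; apply/andP; split; first exact: outer_translate_le.
rewrite -{1}(translateK s A); exact: outer_translate_le.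
Qed.

Lemma measurable_translate s (A : set T) : measurable A -> measurable (translate s A : set T).
Proof.
move=> mA.
suff : caratheodory_measurable (wlength idfun)^*%mu (translate s A) by [].
have {}mA : caratheodory_measurable (wlength idfun)^*%mu A by exact: mA.
move=> X; have := mA (translate (- s) X).
have E B : (wlength idfun)^*%mu (translate (- s) B) = (wlength idfun)^*%mu B :> \bar R.
  exact: (completed_lebesgue_translate (- s) B).
have -> : translate (- s) X `&` A = translate (- s) (X `&` translate s A).
  by rewrite -[in LHS](translateK s A).
have -> : translate (- s) X `&` ~` A = translate (- s) (X `&` ~` translate s A).
  by rewrite -[in LHS](translateK s A).
move=> h.
exact: (etrans (esym (E X)) (etrans h (congr2 adde (E _) (E _)))).
Qed.

Lemma finval_translate (Y : Type) s (p : T -> Y) :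
  finval p -> finval (fun h : T => p (s + (h : R))).
Proof.
move=> [pfin pm]; split=> [|y]; last exact: (measurable_translate s (pm y)).
by apply: sub_finite_set pfin => _ [h _ <-]; exists (s + h).
Qed.

End Translation.

(** * Averaging over grids of differences *)

Section GridAverage.
Context {R : realType} {X : completeNormedModType R[i]}.

(** Averaged over an N x N grid, both difference quotients telescope. *)
Lemma grid_average (a : nat -> nat -> X) (c2 c3 : R[i]) (L : X) (M e : R) (N : nat) :
  (0 < N)%N -> (forall j l, (j <= N)%N -> (l <= N)%N -> rnorm (a j l) <= M) ->
  rnorm c2 <= 2 -> rnorm c3 <= 2 ->
  (forall j l, (j < N)%N -> (l < N)%N ->
    rnorm (c2 *: (a j.+1 l - a j l) + c3 *: (a j l.+1 - a j l) - L) <= e) ->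
  rnorm L <= e + 8 * M / N%:R.
Proof.
move=> N0 aM c2_le c3_le small; have NR : 0 < N%:R :> R by rewrite ltr0n.
pose S := \sum_(j < N) \sum_(l < N) (c2 *: (a j.+1 l - a j l) + c3 *: (a j l.+1 - a j l)).
have M0 : 0 <= M by apply: le_trans (aM 0%N 0%N isT isT); exact: rnorm_ge0.
have S_le : rnorm S <= 8 * M * N%:R.
  have -> : S = c2 *: (\sum_(l < N) (a N l - a 0%N l)) + c3 *: (\sum_(j < N) (a j N - a j 0%N)).
    rewrite /S; under eq_bigr do rewrite big_split; rewrite big_split /=; congr (_ + _).
      rewrite exchange_big /= scaler_sumr; apply: eq_bigr => l _.
      by rewrite -scaler_sumr -(big_mkord predT (fun j => a j.+1 l - a j l)) telescope_sumr.
    rewrite scaler_sumr; apply: eq_bigr => j _.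
    by rewrite -scaler_sumr -(big_mkord predT (fun l => a j l.+1 - a j l)) telescope_sumr.
  have bnd (F : 'I_N -> X) : (forall i, rnorm (F i) <= 2 * M) -> rnorm (\sum_i F i) <= 2 * M * N%:R.
    move=> FM; rewrite (le_trans (rnorm_sum _ _ _))//.
    rewrite (le_trans (ler_sum _ (fun i _ => FM i)))//.
    by rewrite sumr_const card_ord mulr_natr.
  have diff x y : rnorm x <= M -> rnorm y <= M -> rnorm (x - y : X) <= 2 * M.
    by move=> xM yM; rewrite (le_trans (rnormB _ _))// mulr_natl mulr2n lerD.
  rewrite (le_trans (rnormD _ _))// !rnormZ.
  apply: (@le_trans _ _ (2 * (2 * M * N%:R) + 2 * (2 * M * N%:R))); last lra.
  apply: lerD; apply: ler_pM; rewrite ?rnorm_ge0//; apply: bnd => i; apply: diff; apply: aM => //; exact: ltnW.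
have SL_le : rnorm (S - L *+ (N * N)) <= e * (N%:R * N%:R).
  have -> : S - L *+ (N * N) = \sum_(j < N) \sum_(l < N)
      (c2 *: (a j.+1 l - a j l) + c3 *: (a j l.+1 - a j l) - L).
    under [RHS]eq_bigr do rewrite sumrB sumr_const card_ord.
    by rewrite sumrB sumr_const card_ord mulrnA.
  rewrite (le_trans (rnorm_sum _ _ _))//.
  apply: (@le_trans _ _ (\sum_(j < N) \sum_(l < N) e)).
    by apply: ler_sum => j _; rewrite (le_trans (rnorm_sum _ _ _))//; apply: ler_sum => l _; exact: small.
  by rewrite !sumr_const !card_ord mulrA !mulr_natr.
have : rnorm (L *+ (N * N)) <= e * (N%:R * N%:R) + 8 * M * N%:R.
  rewrite -[L *+ _](subKr S) (le_trans (rnormB _ _))// addrC.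
  by rewrite lerD.
have -> : rnorm (L *+ (N * N)) = rnorm L * (N%:R * N%:R).
  by rewrite -scaler_nat rnormZ rnorm_nat natrM mulrC.
move=> h; rewrite -(ler_pM2r (mulr_gt0 NR NR)) (le_trans h)// (mulrDl e) lerD2l.
by rewrite mulrA divfK ?gt_eqF.
Qed.

End GridAverage.

Section BadSet.
Context {R : realType} {X : completeNormedModType R[i]}.
Notation cmu := (@completed_lebesgue_measure R).
Notation T := (caratheodory_type (@wlength R idfun)^*%mu).
Variables (J : set R) (Jup : forall s t, J s -> s <= t -> J t).
Variables (f : R -> X) (fm : bochner_measurable cmu J f).

(** The steps h at which the value exceeds e need not form a visibly measurable
    set, since f is only a limit almost everywhere of simple functions. B is the
    upper limit of the corresponding sets for those simple functions, enlarged by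
    the null set Z of steps at which convergence may fail. *)
Lemma bad_set (s1 s2 s3 : R) (c2 c3 : R[i]) (L : X) (e : R) : J s1 -> J s2 -> J s3 ->
  exists B Z : set T, [/\ measurable B, measurable Z, cmu Z = 0%E,
    forall h, 0 < h -> ~ B h ->
      rnorm (c2 *: (f (s2 + h) - f (s1 + h)) + c3 *: (f (s3 + h) - f (s1 + h)) - L) <= e &
    forall h, 0 < h -> ~ Z h ->
      rnorm (c2 *: (f (s2 + h) - f (s1 + h)) + c3 *: (f (s3 + h) - f (s1 + h)) - L) < e -> ~ B h].
Proof.
move=> J1 J2 J3; have [u [us [N [mN N0 uN]]]] := fm.
pose comb (a b c : X) := c2 *: (b - a) + c3 *: (c - a) - L.
pose w m (h : R) := comb (u m (s1 + h)) (u m (s2 + h)) (u m (s3 + h)).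
pose w_ (h : R) := comb (f (s1 + h)) (f (s2 + h)) (f (s3 + h)).
pose S m : set T := [set h | e < rnorm (w m h)].
have mS m : measurable (S m).
  have := finval_pair (finval_pair (finval_translate s1 (us m)) (finval_translate s2 (us m))) (finval_translate s3 (us m)).
  by move=> /(@finval_preimage _ _ _ _ [set z | e < rnorm (comb z.1.1 z.1.2 z.2)]).
pose Z : set T := translate s1 N `|` (translate s2 N `|` translate s3 N).
have mtr s : measurable (translate s N : set T) by exact: measurable_translate.
have mZ : measurable Z by apply: measurableU => //; exact: measurableU.
have trN s : cmu (translate s N) = 0%E by rewrite completed_lebesgue_translate.
have Z0 : cmu Z = 0%E.
  have Z0 : cmu (translate s2 N `|` translate s3 N) = 0%E.
    exact: etrans (measureU0 (mtr s2) (mtr s3) (trN s3)) (trN s2).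
  exact: etrans (measureU0 (mtr s1) (measurableU _ _ (mtr s2) (mtr s3)) Z0) (trN s1).
pose B : set T := Z `|` \bigcap_k \bigcup_(m in [set m | (k <= m)%N]) S m.
have wcvg h : 0 < h -> ~ Z h -> forall d, 0 < d -> \forall m \near \oo, rnorm (w_ h - w m h) < d.
  move=> h0 Zh.
  have uf s : J s -> ~ translate s N h -> u m (s + h) @[m --> \oo] --> f (s + h).
    move=> Js Nh; apply: contrapT => nu; apply: Nh; apply: uN => /= hu; apply: nu; apply: hu.
    by apply: Jup Js _; rewrite lerDl ltW.
  have [u1 u2 u3] : [/\ ~ translate s1 N h, ~ translate s2 N h & ~ translate s3 N h].
    by split=> nh; apply: Zh; [left|right; left|right; right].
  apply/cvg_rnorm; rewrite /w /w_ /comb.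
  by apply: cvgB; [apply: cvgD; apply: cvgZr; apply: cvgB; exact: uf|exact: cvg_cst].
exists B, Z; split => //.
- apply: measurableU => //; apply: bigcapT_measurable => k.
  exact: bigcup_measurable.
- move=> h h0 Bh; have Zh : ~ Z h by move=> Zh; apply: Bh; left.
  rewrite -/(comb _ _ _) -/(w_ h); apply/ler_addgt0Pr => d d0.
  have [k kS] : exists k, forall m, (k <= m)%N -> ~ S m h.
    apply: contrapT => nS; apply: Bh; right => k _.
    apply: contrapT => nk; apply: nS; exists k => m km Sm; apply: nk; exists m => //.
  near \oo => m.
  have km : (k <= m)%N by near: m; exists k.
  have /negP := kS m km; rewrite -leNgt => wm.
  have wd : rnorm (w_ h - w m h) < d by near: m; exact: wcvg.
  rewrite -(subrK (w m h) (w_ h)) addrC (le_trans (rnormD _ _))// lerD// ltW//.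
- move=> h h0 Zh; rewrite -/(comb _ _ _) -/(w_ h) => we [//|Sh].
  have d0 : 0 < e - rnorm (w_ h) by rewrite subr_gt0.
  have [k _ kw] := wcvg h h0 Zh _ d0.
  have [m /= km] := Sh k I; rewrite /S /= => ewm.
  have := kw m km; rewrite /= rdistC => wm.
  have : rnorm (w m h) < e.
    by rewrite -(subrK (w_ h) (w m h)) (le_lt_trans (rnormD _ _))// -ltrBrDr.
  by rewrite ltNge (ltW ewm).
Unshelve. all: by end_near. Qed.

End BadSet.

Section DifferencePrinciple.
Context {R : realType} {X : completeNormedModType R[i]}.
Notation cmu := (@completed_lebesgue_measure R).
Notation T := (caratheodory_type (@wlength R idfun)^*%mu).
Variables (J : set R) (Jup : forall s t, J s -> s <= t -> J t).
Variables (f : R -> X) (fm : bochner_measurable cmu J f).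
Variables (M : R) (fM : forall t, J t -> rnorm (f t) <= M).
Variables (s1 s2 s3 : nat -> R) (c2 c3 : nat -> R[i]).
Hypotheses (J1 : forall n, J (s1 n)) (J2 : forall n, J (s2 n)) (J3 : forall n, J (s3 n)).
Hypotheses (c2_le : forall n, rnorm (c2 n) <= 2) (c3_le : forall n, rnorm (c3 n) <= 2).
Hypotheses (s21 : forall n, `|s2 n - s1 n| < n.+1%:R^-1).
Hypotheses (s31 : forall n, `|s3 n - s1 n| < n.+1%:R^-1).

(** The functionals whose behaviour on differences of f decides the behaviour on f. *)
Definition dipole n (a : R -> X) : X :=
  c2 n *: (a (s2 n) - a (s1 n)) + c3 n *: (a (s3 n) - a (s1 n)).

Hypothesis (dipole_diff : forall h : R, 0 < h -> forall e : R, 0 < e ->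
  exists N, forall n, (N <= n)%N -> rnorm (dipole n (difference h f)) < e).

Lemma dipole_difference n h : dipole n (difference h f) =
  c2 n *: (f (s2 n + h) - f (s1 n + h)) + c3 n *: (f (s3 n + h) - f (s1 n + h)) - dipole n f.
Proof.
have E s : difference h f s - difference h f (s1 n) =
    (f (s + h) - f (s1 n + h)) - (f s - f (s1 n)) by exact: sub_subAC.
have aux (a b c d : X) : c2 n *: (a - b) + c3 n *: (c - d) =
    (c2 n *: a + c3 n *: c) - (c2 n *: b + c3 n *: d).
  by rewrite !scalerBr opprD addrACA.
by rewrite /dipole (E (s2 n)) (E (s3 n)) aux.
Qed.

(** Pointwise convergence to 0 implies convergence in measure on ]0, 1[. *)
Lemma dipole_in_measure (B Z : nat -> set T) (e : R) : 0 < e ->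
  (forall n, measurable (B n)) -> (forall n, measurable (Z n)) ->
  (forall n, cmu (Z n) = 0%E) ->
  (forall n h, 0 < h -> ~ Z n h -> rnorm (dipole n (difference h f)) < e -> ~ B n h) ->
  forall d : R, 0 < d -> exists k, forall n, (k <= n)%N ->
    (cmu (B n `&` `]0%R, 1%R[%classic) < d%:E)%E.
Proof.
move=> e0 mB mZ Z0 BZ d d0.
have mI : measurable (`]0, 1[%classic : set T).
  by apply: borel_measurable_cara; exact: measurable_itv.
(* these sets decrease to a null set: at almost every h, only finitely many B n occur *)
pose F k : set T := \bigcup_(n in [set n | (k <= n)%N]) (B n `&` `]0, 1[%classic).
have mBI n : measurable (B n `&` `]0, 1[%classic : set T) by exact: measurableI.
have mF k : measurable (F k) by exact: bigcup_measurable.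
have mFcap : measurable (\bigcap_k F k) by exact: bigcapT_measurable.
have I1 : (cmu `]0%R, 1%R[%classic < +oo)%E.
  apply: le_lt_trans (completed_lebesgue_segment_fin 0 1).
  apply: le_measure; rewrite ?inE//; first exact: segment_measurable.
  by move=> h; exact: subset_itv_oo_cc.
have F0fin : (cmu (F 0%N) < +oo)%E.
  apply: le_lt_trans I1; apply: le_measure; rewrite ?inE//.
  by move=> h [n _ []].
have Fcap0 : cmu (\bigcap_k F k) = 0%E.
  have Zn : cmu.-negligible (\bigcup_n Z n).
    by apply: negligible_bigcup => n; exists (Z n); split; [exact: mZ|exact: Z0|].
  have : cmu.-negligible (\bigcap_k F k).
    apply: negligibleS Zn => h Fh; apply: contrapT => Zh.
    have [_ _ [_ /=]] := Fh 0%N I; rewrite in_itv /= => /andP[h0 h1].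
    have [N hN] := dipole_diff h0 e0; have [n /= Nn [Bn _]] := Fh N I.
    by apply: BZ Bn => // [Znh|]; [apply: Zh; exists n|exact: hN].
  exact: measure_negligible.
have cvgF : (cmu \o F) n @[n --> \oo] --> 0%E.
  rewrite -[X in _ --> X]Fcap0.
  apply: (nonincreasing_cvg_mu F0fin mF mFcap) => m n mn.
  apply/subsetPset => h [q /= nq Bq]; exists q => //=.
  exact: leq_trans nq.
move/fine_cvgP: cvgF => [fin /cvgrPdist_lt/(_ _ d0) cv0].
have [k _ hk] := filterI fin cv0; exists k => n kn.
have [/= fink dk] := hk k (leqnn k).
apply: (@le_lt_trans _ _ (cmu (F k))).
  by apply: le_measure; rewrite ?inE// => h Bh; exists n.
rewrite -(fineK fink) lte_fin; apply: le_lt_trans dk.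
by rewrite add0r normrN ler_norm.
Qed.

(** The N^2 translates of B cannot cover an interval of length 1/3. *)
Lemma good_grid_base (B : set T) (N : nat) (p q : R) : (0 < N)%N -> measurable B ->
  (cmu B < (3 * N%:R * N%:R)^-1%:E)%E ->
  exists2 h : R, 3^-1 <= h <= 2 / 3 &
    forall j l, (j < N)%N -> (l < N)%N -> ~ B (j%:R * p + l%:R * q + h).
Proof.
move=> N0 mB Bsmall; apply: contrapT => nogood.
have NR : 0 < N%:R :> R by rewrite ltr0n.
pose F j : set T := \big[setU/set0]_(l < N) translate (j%:R * p + l%:R * q) B.
have mtr s : measurable (translate s B : set T) by exact: measurable_translate.
have mF j : measurable (F j) by exact: bigsetU_measurable.
have cover : `[3^-1, 2 / 3]%classic `<=` (\big[setU/set0]_(j < N) F j : set T).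
  move=> h; rewrite /= in_itv /= => hI; apply: contrapT => hF; apply: nogood.
  exists h => // j l jN lN Bh; apply: hF.
  rewrite -bigcup_mkord; exists j => //=.
  by rewrite /F -(bigcup_mkord N (fun l => translate (j%:R * p + l%:R * q) B : set T)); exists l.
have Bfin : cmu B \is a fin_num by rewrite ge0_fin_numE// (lt_trans Bsmall)// ltry.
have F_le j : (cmu (F j) <= (N%:R * fine (cmu B))%:E)%E.
  apply: (le_trans (@Boole_inequality _ _ _ cmu
    (fun l => translate (j%:R * p + l%:R * q) B : set T) N (fun l _ => mtr _))).
  rewrite (eq_bigr (fun=> (fine (cmu B))%:E)); last first.
    by move=> l _; rewrite fineK// -[in RHS](completed_lebesgue_translate (j%:R * p + l%:R * q) B).
  by rewrite sumEFin lee_fin sumr_const card_ord mulr_natl.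
have : (cmu `[3^-1%R, (2 / 3)%R]%classic <= (N%:R * (N%:R * fine (cmu B)))%:E)%E.
  apply: (@le_trans _ _ (cmu (\big[setU/set0]_(j < N) F j))).
    apply: le_measure; rewrite ?inE//; first exact: segment_measurable.
    exact: bigsetU_measurable.
  apply: (le_trans (@Boole_inequality _ _ _ cmu F N (fun j _ => mF j))).
  apply: (@le_trans _ _ (\sum_(j < N) (N%:R * fine (cmu B))%:E)%E).
    by apply: lee_sum => j _; exact: F_le.
  by rewrite sumEFin lee_fin sumr_const card_ord -[leLHS]mulr_natl.
rewrite completed_lebesgue_segment ?lee_fin; last by lra.
move: Bsmall; rewrite -(fineK Bfin) lte_fin /=; move: (fine _) => x xN.
have : N%:R * (N%:R * x) < 3^-1.
  rewrite mulrA -ltr_pdivlMl ?mulr_gt0//; move: xN; rewrite -mulrA invfM.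
  by rewrite [_^-1 * _^-1]mulrC.
lra.
Qed.

(** Take h in [1/3, 2/3] such that all steps of the N x N grid based at h are good.
    The grid stays in ]0, 1[ when the triple is small compared with 1/N. *)
Theorem dipole_small (e : R) : 0 < e -> exists n, rnorm (dipole n f) < e.
Proof.
move=> e0; have e40 : 0 < e / 4 by rewrite divr_gt0.
have /choice[B /choice[Z BZ]] n := bad_set Jup fm (c2 n) (c3 n) (dipole n f) (e / 4) (J1 n) (J2 n) (J3 n).
have M0 : 0 <= M by apply: le_trans (fM (J1 0%N)); exact: rnorm_ge0.
(* the telescoped boundary terms are at most 8 M / N *)
pose N := (Num.truncn (16 * M / e)).+1.
have N0 : 0 < N%:R :> R by rewrite ltr0n.
have MN : 8 * M / N%:R < e / 2.
  rewrite ltr_pdivrMr//; have := truncnS_gt (16 * M / e); rewrite -/N ltr_pdivrMr//.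
  by move: N%:R => x ?; lra.
have [|||||k kB] := @dipole_in_measure B Z (e / 4) e40 _ _ _ _ (3 * N%:R * N%:R)^-1.
- by move=> n; case: (BZ n).
- by move=> n; case: (BZ n).
- by move=> n; case: (BZ n).
- by move=> n h h0 Zh; rewrite dipole_difference; case: (BZ n) => _ _ _ _; exact.
- by rewrite invr_gt0 !mulr_gt0.
(* the factor 6 keeps each coordinate of the grid within 1/6 *)
pose n := maxn k (6 * N)%N; exists n.
have kn : (k <= n)%N by rewrite leq_maxl.
have Nn : N%:R * n.+1%:R^-1 < 6^-1 :> R.
  rewrite ltr_pdivrMr ?ltr0n// -ltr_pdivrMl ?invr_gt0// invrK -natrM ltr_nat ltnS.
  by rewrite leq_maxr.
have mBI : measurable (B n `&` `]0, 1[%classic : set T).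
  apply: measurableI; first by case: (BZ n).
  by apply: borel_measurable_cara; exact: measurable_itv.
set p := s2 n - s1 n; set q := s3 n - s1 n.
have [h0 /andP[h0lo h0hi] good] := good_grid_base p q (isT : (0 < N)%N) mBI (kB n kn).
have grid j l : (j <= N)%N -> (l <= N)%N -> 0 < j%:R * p + l%:R * q + h0 < 1.
  move=> jN lN.
  have bnd (i : nat) (x : R) : (i <= N)%N -> `|x| < n.+1%:R^-1 -> `|i%:R * x| < 6^-1.
    move=> iN xn; apply: le_lt_trans Nn; rewrite normrM normr_nat.
    by rewrite ler_pM ?ler_nat// ltW.
  have := bnd j p jN (s21 n); have := bnd l q lN (s31 n).
  rewrite !ltr_norml => /andP[? ?] /andP[? ?]; apply/andP; split; lra.
have := @grid_average _ _ (fun j l => f (s1 n + (j%:R * p + l%:R * q + h0)))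
  (c2 n) (c3 n) (dipole n f) M (e / 4) N isT _ (c2_le n) (c3_le n) _.
move=> /(_ _ _)/le_lt_trans; apply.
- move=> j l jN lN; apply: fM; apply: Jup (J1 n) _; rewrite lerDl ltW//.
  by case/andP: (grid j l jN lN).
- move=> j l jN lN; have /andP[g0 g1] := grid j l (ltnW jN) (ltnW lN).
  have [_ _ _ + _] := BZ n; move=> /(_ _ g0).
  have -> : s1 n + (j.+1%:R * p + l%:R * q + h0) = s2 n + (j%:R * p + l%:R * q + h0).
    by rewrite -natr1 /p; ring.
  have -> : s1 n + (j%:R * p + l.+1%:R * q + h0) = s3 n + (j%:R * p + l%:R * q + h0).
    by rewrite -natr1 /q; ring.
  apply=> Bh; apply: (good j l jN lN); split=> //=.
  by rewrite in_itv /= g0.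
- by move: MN; move: (8 * M / _) => x ?; lra.
Qed.

End DifferencePrinciple.

(** * Functions with differences in UC + g UC *)

Section UniformDifferencePrinciple.
Context {R : realType} {X : completeNormedModType R[i]}.
Notation cmu := (@completed_lebesgue_measure R).

(** P selects the triples and coefficients on which smallness is required. The
    instances are the coefficients of altg, and c2 = 1, c3 = 0 with s3 = s1, for
    which the property is uniform continuity on a bounded part of J. *)
Definition vanishing (P : R -> R -> R -> R[i] -> R[i] -> Prop) (a : R -> X) :=
  forall e : R, 0 < e -> exists2 d : R, 0 < d &
    forall s1 s2 s3 c2 c3, P s1 s2 s3 c2 c3 -> `|s2 - s1| < d -> `|s3 - s1| < d ->
    rnorm (c2 *: (a s2 - a s1) + c3 *: (a s3 - a s1)) < e.

Theorem vanishing_of_differences (J : set R) P (f : R -> X) :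
  (forall s t, J s -> s <= t -> J t) ->
  bochner_measurable cmu J f -> bounded_on J f ->
  (forall s1 s2 s3 c2 c3, P s1 s2 s3 c2 c3 ->
    [/\ J s1, J s2, J s3, rnorm c2 <= 2 & rnorm c3 <= 2]) ->
  (forall h : R, 0 < h -> vanishing P (difference h f)) -> vanishing P f.
Proof.
move=> Jup fm [M fM] PJ diff e e0; apply: contrapT => nd.
have /choice[q qP] (n : nat) : exists q : R * R * R * R[i] * R[i],
    [/\ P q.1.1.1.1 q.1.1.1.2 q.1.1.2 q.1.2 q.2,
      `|q.1.1.1.2 - q.1.1.1.1| < n.+1%:R^-1, `|q.1.1.2 - q.1.1.1.1| < n.+1%:R^-1 &
      e <= rnorm (q.1.2 *: (f q.1.1.1.2 - f q.1.1.1.1) + q.2 *: (f q.1.1.2 - f q.1.1.1.1))].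
  apply: contrapT => nq; apply: nd; exists n.+1%:R^-1; first by rewrite invr_gt0.
  move=> s1 s2 s3 c2 c3 Ps s21 s31; rewrite ltNge; apply/negP => ele; apply: nq.
  by exists (s1, s2, s3, c2, c3).
pose s1 n := (q n).1.1.1.1; pose s2 n := (q n).1.1.1.2; pose s3 n := (q n).1.1.2.
pose c2 n := (q n).1.2; pose c3 n := (q n).2.
have Pq n : P (s1 n) (s2 n) (s3 n) (c2 n) (c3 n) by case: (qP n).
have s21 n : `|s2 n - s1 n| < n.+1%:R^-1 by case: (qP n).
have s31 n : `|s3 n - s1 n| < n.+1%:R^-1 by case: (qP n).
have ele n : e <= rnorm (dipole s1 s2 s3 c2 c3 n f) by case: (qP n).
suff [n] : exists n, rnorm (dipole s1 s2 s3 c2 c3 n f) < e by rewrite ltNge ele.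
apply: (dipole_small Jup fm fM) => //; try by move=> n; case: (PJ _ _ _ _ _ (Pq n)).
move=> h h0 d d0; have [d' d'0 hd'] := diff h h0 d d0.
exists (Num.truncn d'^-1) => n Nn.
have nd' : n.+1%:R^-1 < d'.
  rewrite invf_plt ?posrE// (lt_le_trans (truncnS_gt _))// ler_nat ltnS//.
by apply: hd' (Pq n) _ _; [exact: lt_trans (s21 n) nd'|exact: lt_trans (s31 n) nd'].
Qed.

End UniformDifferencePrinciple.

Section BoundedDifferences.
Context {R : realType} {X : completeNormedModType R[i]}.
Variables (omega r : R) (omega0 : omega != 0) (r1 : 1 < r).
Local Notation g := (g omega r).
Variables (J : set R) (HJ : unbounded_right_interval J).

Theorem bounded_difference_sum_mul (f : R -> X) : Linfty J f ->
  (forall h : R, 0 < h -> exists u v, [/\ ucont J u, ucont J v &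
     forall t, J t -> difference h f t = u t + g t *: v t]) ->
  sum_mul J g (BUC J) (BUC J) f.
Proof.
move=> [fm /bounded_onP fb] diff; have Jup := unbounded_right_up HJ.
apply: bounded_decomposition => //.
- move=> T.
  pose P s1 s2 s3 (c2 c3 : R[i]) := [/\ J s1 /\ `|s1| <= T, J s2 /\ `|s2| <= T, s3 = s1,
    c2 = 1 & c3 = 0].
  suff fv : vanishing P f.
    move=> e /fv[d d0 fd]; exists d => // s t [Js sT] [Jt tT] st.
    have := fd t s t 1 0; rewrite !subrr normr0 scale1r scale0r addr0; apply => //.
  apply: (vanishing_of_differences Jup fm fb).
    move=> s1 s2 s3 c2 c3 [[J1 _] [J2 _] -> -> ->]; split => //.
      by rewrite (rnorm_nat 1) ler1n.
    by rewrite rnorm0.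
  move=> h h0 e e0; have [u [v [uu vu E]]] := diff h h0.
  have [d d0 hd] := sum_mul_ucont_near r1 (unbounded_right_is_interval HJ) uu vu E T e0.
  exists d => // s1 s2 s3 c2 c3 [[J1 T1] [J2 T2] -> -> ->] s21 _.
  by rewrite scale1r scale0r addr0 hd.
- pose P s1 s2 s3 (c2 c3 : R[i]) := [/\ J s1, J s2, J s3, c2 = g s3 - g s1 & c3 = g s1 - g s2].
  suff fv : vanishing P f.
    by move=> e /fv[d d0 fd]; exists d => // s1 s2 s3 *; apply: fd.
  apply: (vanishing_of_differences Jup fm fb).
    by move=> s1 s2 s3 c2 c3 [J1 J2 J3 -> ->]; split => //; exact: rnorm_gB.
  move=> h h0 e e0; have [u [v [uu vu E]]] := diff h h0.
  have [d d0 hd] := sum_mul_locally_span1g uu vu E e0.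
  by exists d => // s1 s2 s3 c2 c3 [J1 J2 J3 -> ->]; exact: hd.
Qed.

End BoundedDifferences.

Theorem corollary6p13 (R : realType) (X : completeNormedModType R[i])
    (J : set R) (alpha0 omega r : R) (U V : set (R -> X))
    (X_neq0 : exists x : X, x != 0)
    (J_itv : unbounded_right_interval J)
    (J_alpha0 : J alpha0) (alpha0_eq0 : J 0 -> alpha0 = 0)
    (omega_neq0 : omega != 0) (r_gt1_le2 : 1 < r <= 2)
    (U_in : U = BUC J \/ U = UC J) (V_in : V = BUC J \/ V = UC J) :
  satisfies_Lb J (sum_mul J (g omega r) U V) /\
  satisfies_Pb alpha0 J (sum_mul J (g omega r) U V).
Proof.
have /andP[r1 r2] := r_gt1_le2.
have ucont_of (W : set (R -> X)) f : W = BUC J \/ W = UC J -> W f -> ucont J f.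
  by case=> ->; [case=> /UC_ucont|move=> /UC_ucont].
have BUC_sub (W : set (R -> X)) f : W = BUC J \/ W = UC J -> BUC J f -> W f.
  by case=> -> //; case.
have parts f : sum_mul J (g omega r) U V f -> exists u v,
    [/\ ucont J u, ucont J v & forall t, J t -> f t = u t + g omega r t *: v t].
  move=> [u [v [/(ucont_of _ _ U_in) uu /(ucont_of _ _ V_in) vu fE]]].
  by exists u, v.
have widen f : sum_mul J (g omega r) (BUC J) (BUC J) f -> sum_mul J (g omega r) U V f.
  move=> [u [v [/(BUC_sub _ _ U_in) uU /(BUC_sub _ _ V_in) vV fE]]].
  by exists u, v.
have L1 : sum_mul J (g omega r) U V `<=` L1loc J.
  move=> f /parts[u [v [uu vu fE]]].
  exact: (sum_mul_L1loc r1 (unbounded_right_is_interval J_itv) uu vu fE).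
split; split=> //.
- move=> f fb diff; apply: widen; apply: bounded_difference_sum_mul => // h /diff.
  exact: parts.
- move=> f /parts[u [v [uu vu fE]]] /bounded_onP Fb; apply: widen.
  exact: (bounded_primitive_sum_mul omega_neq0 r1 r2 J_itv J_alpha0 uu vu fE Fb).
Qed.
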